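(* Let $G$ be an abelian group. A function $\phi:G\to\mathbb{H}$ is positive definite if and only if there exists a (not necessarily unique) nonnegative finite Radon measure $\mu$ on $G^\delta$ such that $$\phi(g)=\int_{G^\delta}\gamma(g)\,d\mu(\gamma)\quad\text{for all } g\in G.$$
   Context: $\mathbb{H}$ is the real quaternion algebra, $\mathbb{S}=\{q\in\mathbb{H}:|q|=1\}$. For an abelian group $G$, $\phi:G\to\mathbb{H}$ is positive definite if for all $k$, $g_i\in G$, $q_i\in\mathbb{H}$, $\sum_{i,j=1}^k\overline{q_i}\,\phi(g_j-g_i)\,q_j$ is a nonnegative real number. The quaternionic dual $G^\delta=\mathrm{Hom}(G,\mathbb{S})$ is the set of group homomorphisms $G\to\mathbb{S}$, equipped with the topology of pointwise convergence (it is a compact Hausdorff space). Integrals of $\mathbb{H}$-valued functions are taken componentwise. *)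

(* Defs.v *)
From HB Require Import structures.
From mathcomp Require Import all_boot all_order all_algebra.
From mathcomp Require Import all_classical all_reals all_analysis.
Set Implicit Arguments. Unset Strict Implicit. Unset Printing Implicit Defensive.
Import Order.TTheory GRing.Theory Num.Theory.
Import numFieldNormedType.Exports.
Local Open Scope classical_set_scope.
Local Open Scope ring_scope.

Section Quaternions.
Variable R : realType.

(** Real quaternions a + b i + c j + d k, represented as (a, b, c, d) in R^4,
    with the product topology of R^4. *)
Definition quat := (R * R * R * R)%type.

Definition qre (x : quat) : R := x.1.1.1.
Definition qi  (x : quat) : R := x.1.1.2.
Definition qj  (x : quat) : R := x.1.2.
Definition qk  (x : quat) : R := x.2.

Definition mkquat (a b c d : R) : quat := (a, b, c, d).

Definition qone : quat := mkquat 1 0 0 0.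

Definition qmul (x y : quat) : quat :=
  mkquat (qre x * qre y - qi x * qi y - qj x * qj y - qk x * qk y)
         (qre x * qi y + qi x * qre y + qj x * qk y - qk x * qj y)
         (qre x * qj y - qi x * qk y + qj x * qre y + qk x * qi y)
         (qre x * qk y + qi x * qj y - qj x * qi y + qk x * qre y).

Definition qconj (x : quat) : quat := mkquat (qre x) (- qi x) (- qj x) (- qk x).

Definition qnorm2 (x : quat) : R := qre x ^+ 2 + qi x ^+ 2 + qj x ^+ 2 + qk x ^+ 2.

Definition qsum (k : nat) (F : 'I_k -> 'I_k -> quat) : quat :=
  mkquat (\sum_(i < k) \sum_(j < k) qre (F i j))
         (\sum_(i < k) \sum_(j < k) qi (F i j))
         (\sum_(i < k) \sum_(j < k) qj (F i j))
         (\sum_(i < k) \sum_(j < k) qk (F i j)).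

End Quaternions.

Definition positive_definite (R : realType) (G : zmodType) (phi : G -> quat R) :=
  forall (k : nat) (g : 'I_k -> G) (q : 'I_k -> quat R),
    let s := qsum (fun i j => qmul (qmul (qconj (q i)) (phi (g j - g i))) (q j)) in
    [/\ qi s = 0, qj s = 0, qk s = 0 & 0 <= qre s].

Definition qchars (R : realType) (G : zmodType) : set {ptws G -> quat R} :=
  [set gamma | (forall g, qnorm2 (gamma g) = 1) /\
               (forall g h, gamma (g + h) = qmul (gamma g) (gamma h))].

(** The quaternionic dual G^delta = Hom(G, S), with the topology of pointwise
    convergence (subspace topology inherited from the product space H^G). *)
Notation qdual R G := (set_type (@qchars R G)).

Lemma qchar_one (R : realType) (G : zmodType) :
  @qchars R G (fun _ => qone R).
Proof.
split.
  by move=> g; rewrite /qnorm2 /qone /qre /qi /qj /qk /=; rewrite expr1n ?expr0n /= ?addr0.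
move=> g h; rewrite /qmul /qone /mkquat /qre /qi /qj /qk /=.
by rewrite ?mulr1 ?mulr0 ?mul0r ?subr0 ?addr0 ?add0r.
Qed.

Definition qdual_one (R : realType) (G : zmodType) : qdual R G :=
  exist _ (fun _ => qone R) (mem_set (@qchar_one R G)).

HB.instance Definition _ (R : realType) (G : zmodType) :=
  isPointed.Build (qdual R G) (@qdual_one R G).

Definition qdual_borel (R : realType) (G : zmodType) :=
  g_sigma_algebraType (@open (qdual R G)).

(** Nonnegative finite Radon measure on the compact Hausdorff space G^delta:
    a (nonnegative) Borel measure of finite total mass which is inner regular
    by compact sets on all Borel sets (for finite measures this is equivalent to
    the usual definition: outer regular on Borel sets, inner regular on open sets). *)
Definition finite_radon (R : realType) (G : zmodType)
    (mu : {measure set (qdual_borel R G) -> \bar R}) : Prop :=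
  (mu setT < +oo)%E /\
  forall A : set (qdual_borel R G), measurable A ->
    mu A = ereal_sup [set mu K | K in
                       [set K : set (qdual_borel R G) |
                          compact (K : set (qdual R G)) /\ K `<=` A]].

(* Main.v *)
Require Import Defs.
From HB Require Import structures.
From mathcomp Require Import all_boot all_order all_algebra.
From mathcomp Require Import all_classical all_reals all_analysis.
From mathcomp Require Import measurable_realfun ring lra.
Set Implicit Arguments. Unset Strict Implicit. Unset Printing Implicit Defensive.
Import Order.TTheory GRing.Theory Num.Theory numFieldNormedType.Exports.
Local Open Scope classical_set_scope.
Local Open Scope ring_scope.

(** For [phi] the integral of [gamma] against [mu], the quadratic form of [phi] is
    the integral of [|sum_j gamma (g_j) q_j|^2], which is nonnegative.

    Conversely, the positive definite functions with value [1] at [0] form a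
    compact convex set. If [psi] is an extreme point of it, the positive definite
    functions [psi +- (psi (. + a) + psi (. - a)) / 2] are multiples of [psi], so
    that [psi (g + a) + psi (g - a) = 2 Re (psi a) psi g]. Solving this d'Alembert
    equation gives [psi = C + s w] with [C + i s] a complex character and [w]
    imaginary of norm at most [1]: [psi] is an average of two homomorphisms
    [C +- s u] into the unit sphere. By Krein-Milman, a trigonometric polynomial
    that is nonnegative on the dual is nonnegative at every positive definite
    [phi]. Hahn-Banach then yields a positive functional on all bounded functions
    on the dual, whose restriction to indicators is a finitely additive content on
    all subsets; its regularization is the Radon measure. *)

(** * Hahn-Banach on a linear domain [D], later the bounded functions on the dual *)

Section SublinearFunctionals.
Variables (R : realType) (E : lmodType R) (D : set E).
Hypothesis D_add : forall x y, D x -> D y -> D (x + y).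
Hypothesis D_scale : forall t x, D x -> D (t *: x).

Definition sublinear_on (q : E -> R) :=
  (forall x y, D x -> D y -> q (x + y) <= q x + q y) /\
  (forall t x, 0 < t -> D x -> q (t *: x) <= t * q x).

(** The reverse inequality comes from scaling back by [t^-1]. At [t = 0], scaling the zero vector by
    [2] and by [2^-1] forces [q 0 = 0]. *)
Lemma sublinear_scale q t x : sublinear_on q -> 0 <= t -> D x ->
  q (t *: x) = t * q x.
Proof.
move=> [qD qZ] + Dx; rewrite le_eqVlt => /predU1P[<-|t0].
  rewrite scale0r mul0r.
  have D0 : D 0 by rewrite -(scale0r x); exact: D_scale.
  have := qZ 2 0 ltac:(lra) D0; have := qZ 2^-1 0 ltac:(lra) D0.
  rewrite !scaler0; lra.
apply/eqP; rewrite eq_le qZ//=.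
have ti : 0 < t^-1 by rewrite invr_gt0.
have := qZ t^-1 _ ti (D_scale t Dx).
by rewrite scalerA mulVf ?gt_eqF// scale1r ler_pdivlMl.
Qed.

Lemma sublinear_opp q x : sublinear_on q -> D x -> - q (- x) <= q x.
Proof.
move=> sq Dx; have DNx : D (- x) by rewrite -scaleN1r; exact: D_scale.
have := sq.1 _ _ Dx DNx; rewrite subrr -{1}(scale0r x) sublinear_scale//; lra.
Qed.

Definition dominated_on (p q : E -> R) := forall x, D x -> q x <= p x.

(** The infimum is finite because [- p (- x)] bounds every member from below. It is subadditive
    because the smaller of two comparable members can replace the other one. *)
Lemma inf_chain_sublinear (p : E -> R) (A : set (E -> R)) : A !=set0 ->
  (forall q, A q -> sublinear_on q /\ dominated_on p q) ->
  total_on A (fun q1 q2 => dominated_on q1 q2) ->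
  let r x := inf [set q x | q in A] in
  sublinear_on r /\ (forall q, A q -> dominated_on q r).
Proof.
move=> [q0 Aq0] Asub Atot r.
have rle q x : A q -> D x -> r x <= q x.
  move=> Aq Dx; apply: ge_inf; last by exists q.
  exists (- p (- x)) => _ [q' /Asub[sq' q'p] <-].
  have DNx : D (- x) by rewrite -scaleN1r; exact: D_scale.
  by apply: le_trans (sublinear_opp sq' Dx); rewrite lerN2 q'p.
have rge x c : (forall q, A q -> c <= q x) -> c <= r x.
  move=> h; apply: lb_le_inf; first by exists (q0 x), q0.
  by move=> _ [q Aq <-]; exact: h.
split; last by move=> q Aq x Dx; exact: rle.
split=> [x y Dx Dy|t x t0 Dx].
  have Dxy := D_add Dx Dy.
  rewrite -lerBlDl; apply/rge => q1 Aq1; rewrite lerBlDl -lerBlDr.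
  apply/rge => q2 Aq2; rewrite lerBlDr.
  have [q12|q21] := Atot _ _ Aq1 Aq2.
    have [[qD _] _] := Asub _ Aq2.
    by rewrite (le_trans (rle _ _ Aq2 Dxy))// (le_trans (qD _ _ Dx Dy))// lerD2l q12.
  have [[qD _] _] := Asub _ Aq1.
  by rewrite (le_trans (rle _ _ Aq1 Dxy))// (le_trans (qD _ _ Dx Dy))// lerD2r q21.
rewrite -ler_pdivrMl//; apply/rge => q Aq; rewrite ler_pdivrMl//.
by rewrite (le_trans (rle _ _ Aq (D_scale t Dx)))//; exact: (Asub _ Aq).1.2.
Qed.

(** Zorn's lemma for the reversed pointwise order: a nonempty chain is bounded by its infimum, the
    empty one by [p]. *)
Lemma minimal_sublinear (p : E -> R) : sublinear_on p ->
  exists q, [/\ sublinear_on q, dominated_on p q &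
    forall q', sublinear_on q' -> dominated_on q q' -> dominated_on q' q].
Proof.
move=> sp; pose T := {q : E -> R | sublinear_on q /\ dominated_on p q}.
pose leT (q1 q2 : T) := `[< dominated_on (sval q1) (sval q2) >].
have pp : sublinear_on p /\ dominated_on p p by split.
have [||A Atot|[q [sq qp]] qmin] := @ZL_preorder T (exist _ p pp) leT.
- by move=> t; apply/asboolP.
- move=> r s t /asboolP rs /asboolP st; apply/asboolP => x Dx.
  exact: le_trans (st _ Dx) (rs _ Dx).
- have [A0|/set0P[a Aa]] := eqVneq A set0.
    by exists (exist _ p pp) => s; rewrite A0.
  have A'0 : (sval @` A) !=set0 by exists (sval a), a.
  have A'sub q : (sval @` A) q -> sublinear_on q /\ dominated_on p q.
    by move=> [s _ <-]; exact: (svalP s).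
  have A'tot : total_on (sval @` A) (fun q1 q2 => dominated_on q1 q2).
    move=> _ _ [s As <-] [t At <-].
    by have [/asboolP|/asboolP] := Atot _ _ As At; [left|right].
  have [sr rle] := inf_chain_sublinear A'0 A'sub A'tot.
  set r := (X in sublinear_on X) in sr.
  have rp : dominated_on p r.
    move=> x Dx; apply: le_trans (rle (sval a) _ x Dx) _; first by exists a.
    exact: (svalP a).2.
  exists (exist _ r (conj sr rp)) => s As; apply/asboolP; apply: rle.
  by exists s.
exists q; split=> // q' sq' q'q.
have q'p : dominated_on p q' by move=> x Dx; exact: le_trans (q'q _ Dx) (qp _ Dx).
have := qmin (exist _ q' (conj sq' q'p)).
by move=> h; apply/asboolP; apply: h; apply/asboolP.
Qed.

(** Finiteness follows from [t * q y = q (t *: y) <= q (x + t *: y) + q (- x)]. For sums the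
    parameters [t] add up, and for a multiple by [s] the parameter becomes [s * t]. *)
Lemma inf_translate_sublinear (q : E -> R) (y : E) : sublinear_on q -> D y ->
  let r x := inf [set q (x + t *: y) - t * q y | t in [set t | 0 <= t]] in
  sublinear_on r /\ (forall x t, D x -> 0 <= t -> r x <= q (x + t *: y) - t * q y).
Proof.
move=> sq Dy r.
have DN x : D x -> D (- x) by rewrite -scaleN1r; exact: D_scale.
have rle x t : D x -> 0 <= t -> r x <= q (x + t *: y) - t * q y.
  move=> Dx t0; apply: ge_inf; last by exists t.
  exists (- q (- x)) => _ [s s0 <-]; rewrite -(sublinear_scale sq s0 Dy).
  have Dsy := D_scale s Dy.
  have := sq.1 (x + s *: y) (- x) (D_add Dx Dsy) (DN _ Dx).
  by rewrite addrAC subrr add0r; lra.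
have rge x c : (forall t, 0 <= t -> c <= q (x + t *: y) - t * q y) -> c <= r x.
  move=> h; apply: lb_le_inf; first by exists (q (x + 0 *: y) - 0 * q y), 0 => /=.
  by move=> _ [t t0 <-]; exact: h.
split=> //; split=> [x z Dx Dz|s x s0 Dx].
  rewrite -lerBlDl; apply/rge => t1 t10; rewrite lerBlDl -lerBlDr.
  apply/rge => t2 t20; rewrite lerBlDr.
  have := rle _ _ (D_add Dx Dz) (addr_ge0 t20 t10).
  have := sq.1 (x + t2 *: y) (z + t1 *: y) (D_add Dx (D_scale t2 Dy))
    (D_add Dz (D_scale t1 Dy)).
  by rewrite addrACA -scalerDl mulrDl; lra.
rewrite -ler_pdivrMl//; apply/rge => t t0; rewrite ler_pdivrMl//.
rewrite (le_trans (rle _ _ (D_scale s Dx) (mulr_ge0 (ltW s0) t0)))//.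
have := sq.2 _ _ s0 (D_add Dx (D_scale t Dy)).
by rewrite scalerDr scalerA mulrBr mulrA; lra.
Qed.

(* A minimal sublinear functional is dominated by each of its directional
   regularisations [inf_t (q (x + t y) - t q y)], which forces additivity. *)
Lemma dominated_linear (p : E -> R) : sublinear_on p ->
  exists L : E -> R, [/\ dominated_on p L,
    forall x y, D x -> D y -> L (x + y) = L x + L y &
    forall t x, D x -> L (t *: x) = t * L x].
Proof.
move=> sp; have [q [sq qp qmin]] := minimal_sublinear sp.
have qD x y : D x -> D y -> q (x + y) = q x + q y.
  move=> Dx Dy; apply/eqP; rewrite eq_le sq.1//=.
  have [sr rle] := inf_translate_sublinear sq Dy.
  have rq : dominated_on q (fun x => inf [set q (x + t *: y) - t * q y | t in [set t | 0 <= t]]).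
    by move=> z Dz; have := rle z 0 Dz (lexx _); rewrite scale0r addr0 mul0r subr0.
  (* Minimality puts [q x] below the infimum, whose term at [t = 1] is [q (x + y) - q y]. *)
  have := qmin _ sr rq x Dx; have := rle x 1 Dx ler01.
  by rewrite scale1r mul1r; lra.
exists q; split=> // t x Dx.
have [t0|t0] := leP 0 t; first exact: sublinear_scale.
have Dt := D_scale t Dx; have DNt := D_scale (- t) Dx.
have := qD _ _ Dt DNt; rewrite -scalerDl subrr (sublinear_scale sq (lexx 0) Dx).
by rewrite (@sublinear_scale _ (- t) _ sq _ Dx) ?oppr_ge0 ?ltW//; lra.
Qed.

End SublinearFunctionals.

(** * From a finitely additive content on all subsets of a compact Hausdorff space to a Radon
    measure *)

Section Regularization.
Variables (R : realType) (T : ptopologicalType) (m : set T -> R).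
Hypothesis T_hausdorff : hausdorff_space T.
Hypothesis T_compact : compact [set: T].
Hypothesis m_ge0 : forall A, 0 <= m A.
Hypothesis m_add : forall A B, A `&` B = set0 -> m (A `|` B) = m A + m B.

Local Open Scope ereal_scope.

Lemma content_set0 : m set0 = 0%R.
Proof. by have := m_add (setI0 set0); rewrite setU0; lra. Qed.

Lemma content_le A B : A `<=` B -> (m A <= m B)%R.
Proof.
move=> AB; rewrite -(setUIDK B A) m_add; last by rewrite setDE setIACA setICr setI0.
by rewrite (setIidr AB) lerDl.
Qed.

Lemma content_leU A B : (m (A `|` B) <= m A + m B)%R.
Proof.
rewrite -(setUIDK (A `|` B) A) m_add; last by rewrite setDE setIACA setICr setI0.
by apply: lerD; apply: content_le => x; [case|move=> [[|]]].
Qed.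

(** First half of the classical construction from a content: open sets are measured from inside by
    closed (here compact) sets, then arbitrary sets from outside by open ones. *)
Definition inner_content (U : set T) : \bar R :=
  ereal_sup [set (m K)%:E | K in [set K | closed K /\ K `<=` U]].

Definition outer_content (A : set T) : \bar R :=
  ereal_inf [set inner_content U | U in [set U | open U /\ A `<=` U]].

Lemma le_inner_content K U : closed K -> K `<=` U -> (m K)%:E <= inner_content U.
Proof. by move=> cK KU; apply: ereal_sup_ubound; exists K. Qed.

Lemma inner_content_le U x :
  (forall K, closed K -> K `<=` U -> (m K)%:E <= x) -> inner_content U <= x.
Proof. by move=> h; apply: ge_ereal_sup => _ [K [cK KU] <-]; exact: h. Qed.

Lemma outer_content_le A U : open U -> A `<=` U -> outer_content A <= inner_content U.
Proof. by move=> oU AU; apply: ereal_inf_lbound; exists U. Qed.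

Lemma le_outer_content A x :
  (forall U, open U -> A `<=` U -> x <= inner_content U) -> x <= outer_content A.
Proof. by move=> h; apply: le_ereal_inf_tmp => _ [U [oU AU] <-]; exact: h. Qed.

Lemma inner_contentS U V : U `<=` V -> inner_content U <= inner_content V.
Proof.
move=> UV; apply: inner_content_le => K cK KU.
by apply: le_inner_content => //; exact: subset_trans UV.
Qed.

Lemma inner_content_ge0 U : 0 <= inner_content U.
Proof.
have := @le_inner_content set0 U closed0 (@sub0set _ U).
by rewrite content_set0.
Qed.

Lemma inner_content_le_content U : inner_content U <= (m U)%:E.
Proof. by apply: inner_content_le => K _ KU; rewrite lee_fin content_le. Qed.

Lemma outer_content_open U : open U -> outer_content U = inner_content U.
Proof.
move=> oU; apply/eqP; rewrite eq_le outer_content_le//=.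
by apply: le_outer_content => V _; exact: inner_contentS.
Qed.

Lemma outer_contentS A B : A `<=` B -> outer_content A <= outer_content B.
Proof.
move=> AB; apply: le_outer_content => U oU BU; apply: outer_content_le => //.
exact: subset_trans BU.
Qed.

Lemma outer_content_ge0 A : 0 <= outer_content A.
Proof. by apply: le_outer_content => U _ _; exact: inner_content_ge0. Qed.

(** The whole space is both open and closed, so regularization keeps its mass. *)
Lemma outer_contentT : outer_content setT = (m setT)%:E.
Proof.
rewrite outer_content_open; last exact: openT.
apply/eqP; rewrite eq_le inner_content_le_content/=.
by apply: le_inner_content => //; exact: closedT.
Qed.

Lemma outer_content_fin A : outer_content A \is a fin_num.
Proof.
rewrite ge0_fin_numE ?outer_content_ge0//.
by rewrite (le_lt_trans (outer_contentS (@subsetT _ A)))// outer_contentT ltry.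
Qed.

Lemma inner_content_fin U : inner_content U \is a fin_num.
Proof.
rewrite ge0_fin_numE ?inner_content_ge0//.
by rewrite (le_lt_trans (inner_content_le_content _))// ltry.
Qed.

Lemma outer_content0 : outer_content set0 = 0.
Proof.
rewrite outer_content_open; last exact: open0.
apply/eqP; rewrite eq_le inner_content_ge0 andbT.
by have := inner_content_le_content set0; rewrite content_set0.
Qed.

(** [K] minus [U] and [K] minus [V] are disjoint closed sets. Normality separates them by open sets,
    and removing each of these from [K] gives the two pieces. *)
Lemma closed_split (K U V : set T) : closed K -> open U -> open V ->
  K `<=` U `|` V ->
  exists K1 K2, [/\ closed K1, closed K2, K1 `<=` U, K2 `<=` V & K `<=` K1 `|` K2].
Proof.
move=> cK oU oV KUV.
have cKU : closed (K `\` U) by rewrite setDE; apply: closedI => //; exact: open_closedC.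
have cKV : closed (K `\` V) by rewrite setDE; apply: closedI => //; exact: open_closedC.
have dis : (K `\` U) `&` (K `\` V) = set0.
  by rewrite -subset0 => x [[/KUV[]]// Vx _ []].
have /normal_openP nT := compact_normal T_hausdorff T_compact.
have [U' [V' [oU' oV' KU' KV' UV']]] := nT R _ _ cKU cKV dis.
exists (K `\` U'), (K `\` V'); split.
- by rewrite setDE; apply: closedI => //; exact: open_closedC.
- by rewrite setDE; apply: closedI => //; exact: open_closedC.
- by move=> x [Kx nU'x]; apply: contrapT => nUx; apply: nU'x; exact: KU'.
- by move=> x [Kx nV'x]; apply: contrapT => nVx; apply: nV'x; exact: KV'.
move=> x Kx; have [U'x|] := pselect (U' x); last by left.
by right; split=> // V'x; have : (U' `&` V') x by []; rewrite UV'.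
Qed.

Lemma inner_contentU U V : open U -> open V ->
  inner_content (U `|` V) <= inner_content U + inner_content V.
Proof.
move=> oU oV; apply: inner_content_le => K cK KUV.
have [K1 [K2 [cK1 cK2 K1U K2V KK]]] := closed_split cK oU oV KUV.
apply: le_trans (leeD (le_inner_content cK1 K1U) (le_inner_content cK2 K2V)).
by rewrite -EFinD lee_fin (le_trans (content_le KK))// content_leU.
Qed.

(** A closed set inside the union is compact, so finitely many [U i] cover it and binary
    subadditivity suffices. *)
Lemma inner_content_bigcup (U : (set T)^nat) : (forall n, open (U n)) ->
  inner_content (\bigcup_n U n) <= \sum_(i <oo) inner_content (U i).
Proof.
move=> oU; apply: inner_content_le => K cK KU.
have : cover_compact K.
  by rewrite -compact_cover; exact: subclosed_compact T_compact _.
move=> /(_ nat setT U (fun i _ => oU i) KU)[D' _ KD'].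
have fin n : inner_content (\big[setU/set0]_(i < n) U i) <=
    \sum_(0 <= i < n) inner_content (U i).
  elim: n => [|n IH].
    by rewrite big_ord0 big_geq// -outer_content_open ?outer_content0//; exact: open0.
  rewrite big_ord_recr big_nat_recr//=; apply: le_trans (leeD IH (lexx _)).
  apply: inner_contentU => //; rewrite -bigcup_mkord; exact: bigcup_open.
pose N := (\max_(i <- finmap.enum_fset D') i).+1.
have KN : K `<=` \big[setU/set0]_(i < N) U i.
  move=> x /KD'[i iD Uix]; rewrite -bigcup_mkord; exists i => //=.
  by rewrite ltnS (@leq_bigmax_seq nat _ xpredT id i).
apply: le_trans (le_inner_content cK KN) _; apply: le_trans (fin N) _.
by apply: nneseries_lim_ge => n _ _; exact: inner_content_ge0.
Qed.

Lemma outer_content_sigma_subadditive : sigma_subadditive outer_content.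
Proof.
move=> A; apply/lee_addgt0Pr => e e0.
rewrite (le_trans _ (epsilon_trick _ _ (ltW e0)))//; last first.
  by move=> n; exact: outer_content_ge0.
(* Each [A n] gets an open superset with error [e / 2 ^ n.+1]; these errors sum to at most [e]. *)
pose P n (U : set T) := [/\ open U, A n `<=` U &
  inner_content U <= outer_content (A n) + (e / (2 ^ n.+1)%:R)%:E].
have [U PU] : {U : (set T)^nat & forall n, P n (U n)}.
  apply: (@choice _ _ P) => n.
  have en : (0 < e / (2 ^ n.+1)%:R)%R by rewrite divr_gt0// ltr0n expn_gt0.
  have [_ [U [oU AU] <-] /ltW Ule] := lb_ereal_inf_adherent en (outer_content_fin (A n)).
  by exists U.
have oU n : open (U n) by have [] := PU n.
apply: le_trans (_ : _ <= inner_content (\bigcup_n U n)) _.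
  apply: outer_content_le; first exact: bigcup_open.
  by apply: subset_bigcup => n _; have [] := PU n.
apply: le_trans (inner_content_bigcup oU) _.
apply: lee_nneseries => [n _ _|n _]; first exact: inner_content_ge0.
by have [] := PU n.
Qed.

HB.instance Definition _ := isOuterMeasure.Build R T outer_content
  outer_content0 outer_content_ge0 outer_contentS outer_content_sigma_subadditive.

(** For [V] open around [X], take a closed [K] inside [V] and [U], and then a closed [K'] inside [V]
    minus [K]. They are disjoint with closed union in [V], so [m K + m K'] is at most the inner
    content of [V]; suprema over [K'] and [K] give the splitting. *)
Lemma open_caratheodory U : open U -> outer_content.-caratheodory U.
Proof.
move=> oU; apply: le_caratheodory_measurable => X.
apply: le_outer_content => V oV XV.
apply: le_trans (_ : _ <= outer_content (V `&` U) + outer_content (V `&` ~` U)) _.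
  by apply: leeD; apply: outer_contentS; exact: setSI.
rewrite outer_content_open; last exact: openI.
rewrite -leeBrDr ?outer_content_fin//; apply: inner_content_le => K cK KVU.
rewrite leeBrDr ?outer_content_fin// addeC -leeBrDr//.
have oVK : open (V `&` ~` K) by apply: openI => //; exact: closed_openC.
apply: le_trans (outer_content_le oVK _) _.
  by move=> x [Vx nUx]; split=> // /KVU[].
apply: inner_content_le => K' cK' K'V; rewrite leeBrDr// -EFinD -m_add.
  apply: le_inner_content; first exact: closedU.
  by move=> x [/K'V[]|/KVU[]].
by rewrite -subset0 => x [/K'V[]].
Qed.

Definition borel := g_sigma_algebraType (@open T).

Lemma borel_caratheodory (A : set borel) : measurable A -> outer_content.-caratheodory A.
Proof.
apply: smallest_sub; last by move=> U; exact: open_caratheodory.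
split; first exact: caratheodory_measurable_set0.
  by move=> B cB; rewrite setTD; exact: caratheodory_measurable_setC.
by move=> F cF; exact: caratheodory_measurable_bigcup.
Qed.

Definition radon_of_content (A : set borel) : \bar R := outer_content A.

Lemma radon_of_content_sigma_additive : semi_sigma_additive radon_of_content.
Proof.
move=> F mF tF mUF; apply: (@caratheodory_measure_sigma_additive R T outer_content) => //.
  by move=> i; exact: borel_caratheodory.
exact: borel_caratheodory.
Qed.

HB.instance Definition _ := isMeasure.Build _ borel R radon_of_content
  outer_content0 outer_content_ge0 radon_of_content_sigma_additive.


Lemma closed_borel (K : set T) : closed K -> measurable (K : set borel).
Proof.
move=> cK; rewrite -(setCK K); apply: (@measurableC _ borel).
by apply: sub_sigma_algebra; exact: closed_openC.
Qed.

(** Equality can fail: mass that [m] places arbitrarily near [K] but off it may be moved onto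
    [K]. *)
Lemma radon_of_content_ge K : closed K -> (m K)%:E <= radon_of_content K.
Proof.
by move=> cK; apply: le_outer_content => U _ KU; exact: le_inner_content.
Qed.

Lemma radon_of_contentT : radon_of_content setT = (m setT)%:E.
Proof. exact: outer_contentT. Qed.

(** By complementation: if an open [U] around the complement of [A] has almost its mass, then the
    complement of [U] is a compact subset of [A] with almost the mass of [A], since total mass
    splits. *)
Lemma radon_of_content_inner_regular (A : set borel) : measurable A ->
  radon_of_content A = ereal_sup [set radon_of_content K | K in
    [set K : set borel | compact (K : set T) /\ K `<=` A]].
Proof.
move=> mA; apply/eqP; rewrite eq_le; apply/andP; split; last first.
  apply: ge_ereal_sup => _ [K [_ KA] <-]; exact: outer_contentS.
apply/lee_addgt0Pr => e e0.
have [_ [U [oU AU] <-] Ule] := lb_ereal_inf_adherent e0 (outer_content_fin (~` A)).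
have cU : closed (~` U) by exact: open_closedC.
have UA : ~` U `<=` A by move=> x nUx; apply: contrapT => /AU.
apply: le_trans (_ : _ <= radon_of_content (~` U) + e%:E) _; last first.
  rewrite leeD2r//; apply: ereal_sup_ubound; exists (~` U) => //; split=> //.
  exact: subclosed_compact cU T_compact _.
have spl (B : set borel) : measurable B -> (m setT)%:E =
    outer_content B + outer_content (~` B).
  move=> mB; rewrite -radon_of_contentT; have := borel_caratheodory mB setT.
  by rewrite !setTI.
have mU : measurable (~` U : set borel) by exact: closed_borel.
have := spl _ mA; rewrite (spl _ mU) setCK (outer_content_open oU).
rewrite -[inner_content U]fineK ?inner_content_fin//.
move: Ule; rewrite -/(outer_content _) -[inner_content U]fineK ?inner_content_fin//.
rewrite -[outer_content (~` A)]fineK ?outer_content_fin//.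
rewrite /radon_of_content -[outer_content A]fineK ?outer_content_fin//.
rewrite -[outer_content (~` U)]fineK ?outer_content_fin//.
by rewrite -!EFinD lte_fin lee_fin => h [] h2; lra.
Qed.

Lemma radon_regularization : exists mu : {measure set borel -> \bar R},
  [/\ mu setT = (m setT)%:E,
      forall K : set T, closed K -> (m K)%:E <= mu K &
      forall A, measurable A -> mu A = ereal_sup [set mu K | K in
        [set K : set borel | compact (K : set T) /\ K `<=` A]]].
Proof.
exists radon_of_content; split; [exact: radon_of_contentT|exact: radon_of_content_ge|].
exact: radon_of_content_inner_regular.
Qed.

End Regularization.

(** * Riesz-Markov representation of positive functionals *)

Lemma continuous_borel_measurable (R : realType) (T : ptopologicalType) (f : T -> R) : continuous f ->
  measurable_fun setT (f : borel T -> R).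
Proof.
move=> /continuousP cf; apply: (measurability _ (RGenOpens.measurableE R)).
move=> _ [_ [a [b ->] <-]]; rewrite setTI; apply: sub_sigma_algebra.
exact/cf/interval_open.
Qed.



(** The sum counts the integers from [1] to [N] that are at most [z], so it is the minimum of [N]
    and the floor of [z]. *)
Lemma floor_count_bounds (R : realType) (N : nat) (z : R) : 0 <= z ->
  let S := \sum_(k < N) (if k.+1%:R <= z then 1 else 0) in
  S <= z /\ (z <= N%:R -> z <= S + 1).
Proof.
move=> z0; elim: N => [|N [IH1 IH2]] /=; first by rewrite big_ord0; split=> //; lra.
have full : N%:R <= z -> \sum_(k < N) (if k.+1%:R <= z then 1 else 0) = N%:R :> R.
  move=> Nz; rewrite (eq_bigr (fun=> 1)) ?sumr_const ?card_ord// => i _.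
  by rewrite ifT// (le_trans _ Nz)// ler_nat.
rewrite big_ord_recr/= -natr1; case: ifPn => [zN|].
  by rewrite full; [split; lra|lra].
rewrite -ltNge => zN; rewrite addr0; split=> // _.
by have [/IH2//|/ltW/full ->] := leP z N%:R; lra.
Qed.

Section RieszMarkov.
Variables (R : realType) (T : ptopologicalType) (L : (T -> R) -> R).
Hypothesis T_hausdorff : hausdorff_space T.
Hypothesis T_compact : compact [set: T].

Definition bounded_real (f : T -> R) := exists M, forall x, `|f x| <= M.

Hypothesis L_add : forall f g, bounded_real f -> bounded_real g ->
  L (fun x => f x + g x) = L f + L g.
Hypothesis L_scale : forall t f, bounded_real f -> L (fun x => t * f x) = t * L f.
Hypothesis L_ge0 : forall f, bounded_real f -> (forall x, 0 <= f x) -> 0 <= L f.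

Lemma bounded_cst c : bounded_real (fun=> c).
Proof. by exists `|c|. Qed.

Lemma bounded_add f g : bounded_real f -> bounded_real g ->
  bounded_real (fun x => f x + g x).
Proof.
by move=> [M fM] [N gN]; exists (M + N) => x; rewrite (le_trans (ler_normD _ _))// lerD.
Qed.

Lemma bounded_scale t f : bounded_real f -> bounded_real (fun x => t * f x).
Proof.
by move=> [M fM]; exists (`|t| * M) => x; rewrite normrM ler_wpM2l.
Qed.

Lemma bounded_indic (A : set T) : bounded_real \1_A.
Proof. by exists 1 => x; rewrite indicE; case: (_ \in _); rewrite ?normr0 ?normr1. Qed.

Lemma functional_le f g : bounded_real f -> bounded_real g ->
  (forall x, f x <= g x) -> L f <= L g.
Proof.
move=> bf bg fg; have bN := bounded_scale (-1) bf.
have := L_ge0 (bounded_add bg bN); rewrite L_add// L_scale// => h.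
by have := h (fun x => ltac:(have := fg x; lra)); lra.
Qed.

(** As [L] is defined on all bounded functions, indicators yield a content directly, without
    approximation by continuous functions. *)
Let m (A : set T) : R := L \1_A.

Let m_ge0 A : 0 <= m A.
Proof. by apply: L_ge0; [exact: bounded_indic|move=> x; rewrite indicE]. Qed.

Let m_add A B : A `&` B = set0 -> m (A `|` B) = m A + m B.
Proof.
move=> AB; rewrite /m -L_add; try exact: bounded_indic.
congr L; apply/funext => x; rewrite !indicE in_setU.
have [Ax|] := boolP (x \in A); have [Bx|] := boolP (x \in B) => /=; try by lra.
by move: Ax Bx; rewrite !inE => Ax Bx; have : (A `&` B) x by []; rewrite AB.
Qed.


Section Integral.
Variable mu : {measure set borel T -> \bar R}.
Hypothesis muT : mu setT = (m setT)%:E.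
Hypothesis mu_closed : forall K : set T, closed K -> ((m K)%:E <= mu K)%E.

Lemma bounded_integrable (f : borel T -> R) : bounded_real f -> measurable_fun setT f ->
  mu.-integrable setT (EFin \o f).
Proof.
move=> [M fM] mf; apply: measurable_bounded_integrable => //.
  by rewrite muT ltry.
by exists M; split; rewrite ?num_real// => x Mx y _ /=; rewrite (le_trans (fM y))// ltW.
Qed.

(** Only one inequality between [m] and [mu] is available on closed sets, so the comparison is
    carried through a convex cone of functions; equality is recovered later for continuous ones. *)
Let good (f : borel T -> R) :=
  [/\ bounded_real f, measurable_fun setT f & L f <= \int[mu]_x f x].

Let good_add f g : good f -> good g -> good (fun x => f x + g x).
Proof.
move=> [bf mf Lf] [bg mg Lg]; split; [exact: bounded_add|exact: measurable_funD|].
by rewrite L_add// RintegralD ?lerD//; exact: bounded_integrable.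
Qed.

Let good_scale t f : 0 <= t -> good f -> good (fun x => t * f x).
Proof.
move=> t0 [bf mf Lf]; split; [exact: bounded_scale| |].
  by apply: measurable_funM => //; exact: measurable_cst.
by rewrite L_scale// RintegralZl ?ler_wpM2l//; exact: bounded_integrable.
Qed.

Let good_indic K : closed K -> good \1_K.
Proof.
move=> cK; have mK : measurable (K : set (borel T)) by exact: closed_borel.
split; [exact: bounded_indic|exact: measurable_indic|].
have muK : mu K \is a fin_num.
  rewrite ge0_fin_numE ?measure_ge0// (@le_lt_trans _ _ (mu setT))//.
    by apply: le_measure; rewrite ?inE//; exact: measurableT.
  by rewrite muT ltry.
rewrite /Rintegral (@integral_indic _ (borel T) R mu _ measurableT _ mK).
by rewrite setIT -lee_fin fineK//; exact: mu_closed.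
Qed.

Let good0 : good (fun=> 0).
Proof.
split; [exact: bounded_cst|exact: measurable_cst|].
have -> : L (fun=> 0) = 0.
  rewrite -[RHS](mul0r (L (fun=> 0))) -(L_scale 0 (bounded_cst 0)).
  by congr L; apply/funext => x; rewrite mul0r.
exact: Rintegral_ge0.
Qed.

Let good_sum n (c : R) (K : nat -> set T) : 0 <= c -> (forall k, closed (K k)) ->
  good (fun x => \sum_(k < n) c * \1_(K k) x).
Proof.
move=> c0 cK; elim: n => [|n IH].
  by under eq_fun do rewrite big_ord0.
under eq_fun do rewrite big_ord_recr/=.
by apply: good_add => //; apply: good_scale => //; exact: good_indic.
Qed.

(* Layer cake: the closed superlevel sets [h >= k/n] sandwich [h] up to [1/n]. *)
Lemma functional_le_integral (h : T -> R) : continuous h ->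
  (forall x, 0 <= h x <= 1) -> L h <= \int[mu]_x h x.
Proof.
move=> ch h01.
have bh : bounded_real h.
  by exists 1 => x; have /andP[h0 h1] := h01 x; rewrite ger0_norm.
have mh := continuous_borel_measurable ch.
have step n : L h <= \int[mu]_x h x + n.+1%:R^-1 * m setT.
  pose K k := [set x | k.+1%:R <= n.+1%:R * h x].
  have cK k : closed (K k).
    rewrite (_ : K k = (fun x => n.+1%:R * h x) @^-1` [set y | k.+1%:R <= y])//.
    apply: closed_comp; last exact: closed_ge.
    by move=> x _; apply: cvgM; [exact: cvg_cst|exact: ch].
  have n0 : 0 < n.+1%:R^-1 :> R by rewrite invr_gt0.
  have [bs ms Ls] := good_sum n.+1 (ltW n0) cK.
  set s := (fun x => _) in bs ms Ls.
  have sh x : s x <= h x <= s x + n.+1%:R^-1.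
    have /andP[h0 h1] := h01 x.
    have z0 : 0 <= n.+1%:R * h x by rewrite mulr_ge0.
    have zN : n.+1%:R * h x <= n.+1%:R by rewrite ler_piMr.
    have [S1 /(_ zN) S2] := floor_count_bounds n.+1 z0.
    have -> : s x = n.+1%:R^-1 *
        \sum_(k < n.+1) (if k.+1%:R <= n.+1%:R * h x then 1 else 0).
      rewrite /s -mulr_sumr; congr (_ * _); apply: eq_bigr => k _.
      by rewrite indicE /K; case: ifPn => hk; [rewrite mem_set|rewrite memNset//; exact/negP].
    rewrite ler_pdivrMl// S1/= -[X in _ + X]mulr1 -mulrDr ler_pdivlMl//.
  have bc : bounded_real (fun _ : T => n.+1%:R^-1 * 1) by exact: bounded_cst.
  apply: le_trans (_ : L (fun x => s x + n.+1%:R^-1 * 1) <= _).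
    apply: functional_le => //; first exact: bounded_add.
    by move=> x; rewrite mulr1; have /andP[] := sh x.
  rewrite L_add// L_scale; last exact: bounded_cst.
  have -> : L (fun=> 1) = m setT by congr L; apply/funext => x; rewrite indicT.
  rewrite lerD2r (le_trans Ls)//; apply: le_Rintegral => //.
  - exact: bounded_integrable.
  - exact: bounded_integrable.
  - by move=> x _; have /andP[] := sh x.
apply/ler_addgt0Pr => e e0.
(* This [n] is at least [m setT / e], which makes the error [m setT / n.+1] at most [e]. *)
pose n := Num.bound (m setT / e).
apply: le_trans (step n) _; rewrite lerD2l ler_pdivrMl// -ler_pdivrMr//.
have /archi_boundP/ltW/le_trans : 0 <= m setT / e by rewrite divr_ge0// ltW.
by apply; rewrite ler_nat.
Qed.

(** The one-sided bound applies to [(1 + f) / 2] and [(1 - f) / 2], both with values in [[0, 1]].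
    Since [L] and the integral agree on constants, the two bounds force equality. *)
Lemma functional_integral (f : T -> R) : continuous f ->
  (forall x, `|f x| <= 1) -> (L f)%:E = (\int[mu]_x (f x)%:E)%E.
Proof.
move=> cf f1; have bf : bounded_real f by exists 1.
have mf := continuous_borel_measurable cf.
have If := bounded_integrable bf mf.
have I1 : mu.-integrable setT (EFin \o (fun=> 1)).
  by apply: bounded_integrable; [exact: bounded_cst|exact: measurable_cst].
have half t : `|t| = 1 -> 2^-1 * (L (fun=> 1) + t * L f) <=
    2^-1 * (\int[mu]_(x in setT) 1 + t * \int[mu]_x f x).
  move=> t1; have btf := bounded_scale t bf.
  have b1 := bounded_cst 1.
  rewrite -L_scale// -L_add// -L_scale; last exact: bounded_add.
  have Itf : mu.-integrable setT (EFin \o (fun x => t * f x)).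
    by apply: bounded_integrable => //; apply: measurable_funM => //; exact: measurable_cst.
  rewrite -RintegralZl// -RintegralD// -RintegralZl//; last first.
    apply: bounded_integrable; first exact: bounded_add.
    apply: measurable_funD; first exact: measurable_cst.
    by apply: measurable_funM => //; exact: measurable_cst.
  apply: functional_le_integral.
    move=> x; apply: cvgM; first exact: cvg_cst.
    apply: cvgD; first exact: cvg_cst.
    by apply: cvgM; [exact: cvg_cst|exact: cf].
  move=> x; have : `|t * f x| <= 1 by rewrite normrM t1 mul1r.
  by rewrite ler_norml; lra.
have L1 : L (fun=> 1) = \int[mu]_(x in setT) 1.
  rewrite Rintegral_cst// mul1r muT/=; congr L.
  by apply/funext => x; rewrite indicT.
have := half 1 (normr1 _); have := half (-1) (normrN1 _); rewrite L1 => h1 h2.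
have -> : L f = \int[mu]_x f x by lra.
by rewrite /Rintegral fineK//; exact: integrable_fin_num.
Qed.

End Integral.

Theorem riesz_markov : exists mu : {measure set borel T -> \bar R},
  [/\ (mu setT < +oo)%E,
      forall A, measurable A -> mu A = ereal_sup [set mu K | K in
        [set K : set (borel T) | compact (K : set T) /\ K `<=` A]] &
      forall f : T -> R, continuous f -> (forall x, `|f x| <= 1) ->
        (L f)%:E = (\int[mu]_x (f x)%:E)%E].
Proof.
have [mu [muT mu_closed mu_reg]] :=
  radon_regularization T_hausdorff T_compact m_ge0 m_add.
exists mu; split=> //; first by rewrite muT ltry.
by move=> f cf f1; exact: functional_integral.
Qed.

End RieszMarkov.

(** * Extreme maximizers on a compact set, by minimal faces *)

Section ExtremePoints.
Variables (R : realType) (T : topologicalType) (I : Type) (l : I -> T -> R).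
Hypothesis l_continuous : forall i, continuous (l i).
Variable K : set T.
Hypothesis K_compact : compact K.

(** Convexity is expressed through the functionals [l] alone, as [T] carries no linear structure. *)
Definition midpoint (x y z : T) := forall i, l i x = (l i y + l i z) / 2.

Definition face (F : set T) := [/\ closed F, F !=set0, F `<=` K &
  forall x y z, F x -> K y -> K z -> midpoint x y z -> F y /\ F z].

Definition argmax_on (i : I) (F : set T) :=
  [set x | F x /\ forall y, F y -> l i y <= l i x].

(** Compactness gives a maximizer. If the average of two values equals the maximum, both values
    do. *)
Lemma face_argmax i F : face F -> face (argmax_on i F).
Proof.
move=> [cF F0 FK Fmid]; split.
- rewrite (_ : argmax_on i F = F `&` \bigcap_(y in F) [set x | l i y <= l i x]).
    apply: closedI => //; apply: closed_bigI => y Fy.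
    apply: (@closed_comp _ _ (l i) [set r | l i y <= r]); last exact: closed_ge.
    by move=> x _; exact: l_continuous.
  by apply/seteqP; split=> x [Fx h]; split.
- have cptF : compact F by exact: subclosed_compact cF K_compact FK.
  have [|c /set_mem Fc cmax] := compact_EVT_max (f := l i) F0 cptF.
    by apply: continuous_subspaceT; exact: l_continuous.
  by exists c; split=> // y Fy; apply: cmax; exact: mem_set.
- by move=> x [/FK].
- move=> x y z [Fx xmax] Ky Kz xyz; have [Fy Fz] := Fmid _ _ _ Fx Ky Kz xyz.
  have := xyz i; have := xmax _ Fy; have := xmax _ Fz => hz hy e.
  by split; split=> // t /xmax; lra.
Qed.

(** The members of a chain generate a proper filter on the compact set [K]; a cluster point of it
    lies in all of them because they are closed. *)
Lemma face_bigcap (A : set (set T)) : A !=set0 -> (forall F, A F -> face F) ->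
  total_on A (fun F G => G `<=` F) -> face (\bigcap_(F in A) F).
Proof.
move=> [F0 AF0] Aface Atot; split.
- by apply: closed_bigI => F /Aface[].
- pose B := filter_from A id.
  have BF : ProperFilter B.
    apply: filter_from_proper; last by move=> F /Aface[].
    apply: filter_from_filter; first by exists F0.
    move=> F G AF AG; have [GF|FG] := Atot _ _ AF AG.
      by exists G => // x Gx; split=> //; exact: GF.
    by exists F => // x Fx; split=> //; exact: FG.
  have BK : B K by exists F0 => //; have [] := Aface _ AF0.
  have [x [_ clx]] := K_compact BF BK.
  exists x => F AF; have [cF _ _ _] := Aface _ AF.
  move: clx; rewrite clusterE => /(_ F); rewrite -(closure_id F).1//.
  by apply; exists F.
- by move=> x /(_ _ AF0); have [_ _ FK _] := Aface _ AF0; exact: FK.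
- move=> x y z Fx Ky Kz xyz; split=> F AF; have [_ _ _ Fmid] := Aface _ AF.
    by have [] := Fmid _ _ _ (Fx _ AF) Ky Kz xyz.
  by have [] := Fmid _ _ _ (Fx _ AF) Ky Kz xyz.
Qed.

Lemma minimal_face F0 : face F0 -> exists F, [/\ face F, F `<=` F0 &
  forall F', face F' -> F' `<=` F -> F `<=` F'].
Proof.
move=> fF0; pose S := {F | face F /\ F `<=` F0}.
pose leS (F F' : S) := `[< sval F' `<=` sval F >].
have pF0 : face F0 /\ F0 `<=` F0 by split.
have [||A Atot|[F [fF FF0]] Fmin] := @ZL_preorder S (exist _ F0 pF0) leS.
- by move=> t; apply/asboolP.
- by move=> r s t /asboolP rs /asboolP st; apply/asboolP; exact: subset_trans rs.
- have [A0|/set0P[a Aa]] := eqVneq A set0.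
    by exists (exist _ F0 pF0) => s; rewrite A0.
  have A'0 : (sval @` A) !=set0 by exists (sval a), a.
  have A'f F : (sval @` A) F -> face F by move=> [s _ <-]; exact: (svalP s).1.
  have A'tot : total_on (sval @` A) (fun F G => G `<=` F).
    move=> _ _ [s As <-] [t At <-].
    by have [/asboolP|/asboolP] := Atot _ _ As At; [left|right].
  have ff := face_bigcap A'0 A'f A'tot.
  have sub : \bigcap_(F in sval @` A) F `<=` F0.
    by move=> x /(_ (sval a)) h; apply: (svalP a).2; apply: h; exists a.
  exists (exist (fun F => face F /\ F `<=` F0) _ (conj ff sub)) => s As.
  by apply/asboolP => x /= h; apply: h; exists s.
exists F; split=> // F' fF' F'F.
have F'F0 : F' `<=` F0 by move=> x /F'F; apply: (FF0).
have := Fmin (exist _ F' (conj fF' F'F0)).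
by move=> h; apply/asboolP; apply: h; apply/asboolP.
Qed.

(** Inside the face where [l i0] is maximal, take a minimal face. Its subface of maximizers of any
    [l i] is the whole of it, so every functional is constant there, and a midpoint in it has both
    ends in it. *)
Lemma extreme_maximizer (i0 : I) : closed K -> K !=set0 -> exists x, [/\ K x,
  forall y, K y -> l i0 y <= l i0 x &
  forall y z, K y -> K z -> midpoint x y z -> forall i, l i y = l i x].
Proof.
move=> cK K0; have fK : face K by split.
have [F [fF FF0 Fmin]] := minimal_face (face_argmax i0 fK).
have [_ [x Fx] FK Fmid] := fF.
exists x; split; [exact: FK|by have [] := FF0 _ Fx|].
move=> y z Ky Kz xyz i; have [Fy _] := Fmid _ _ _ Fx Ky Kz xyz.
have sub := Fmin _ (face_argmax i fF) (fun t => @proj1 _ _).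
have [_ xmax] := sub _ Fx; have [_ ymax] := sub _ Fy.
by apply/eqP; rewrite eq_le xmax// ymax.
Qed.

End ExtremePoints.

(** * Quaternion identities and the real inner product *)

Section QuaternionDot.
Variable R : realType.
Implicit Types a b c x y : quat R.

(** The Euclidean inner product of R^4, equal to the real part of [qmul (qconj c) x]; it turns
    quaternionic conditions into real-linear ones. *)
Definition qdot c x : R := qre c * qre x + qi c * qi x + qj c * qj x + qk c * qk x.

Lemma quat_eqP x y : qre x = qre y -> qi x = qi y -> qj x = qj y -> qk x = qk y -> x = y.
Proof.
by case: x => [[[? ?] ?] ?]; case: y => [[[? ?] ?] ?] /=; rewrite /qre /qi /qj /qk /= => -> -> -> ->.
Qed.

(** The real part of a product is invariant under cyclic permutation of its factors. *)
Lemma qdot_sandwich a b x : qre (qmul (qmul (qconj a) x) b) = qdot (qmul a (qconj b)) x.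
Proof. by rewrite /qdot /qmul /qconj /mkquat /qre /qi /qj /qk /=; ring. Qed.

Lemma qdotC x y : qdot x y = qdot y x.
Proof. by rewrite /qdot; ring. Qed.

Lemma qdot_inj x y : (forall c, qdot c x = qdot c y) -> x = y.
Proof.
move=> h; apply: quat_eqP;
 [have := h (mkquat 1 0 0 0)|have := h (mkquat 0 1 0 0)
 |have := h (mkquat 0 0 1 0)|have := h (mkquat 0 0 0 1)];
by rewrite /qdot /mkquat /qre /qi /qj /qk /=; lra.
Qed.

Lemma qdot_conj x y : qdot (qconj x) y = qdot x (qconj y).
Proof. by rewrite /qdot /qconj /mkquat /qre /qi /qj /qk /=; ring. Qed.

Lemma qconjK x : qconj (qconj x) = x.
Proof. by apply: quat_eqP; rewrite /qconj /mkquat /qre /qi /qj /qk /= ?opprK. Qed.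

Lemma qmul1q x : qmul (qconj (qone R)) x = x.
Proof. by apply: quat_eqP; rewrite /qmul /qconj /qone /mkquat /qre /qi /qj /qk /=; ring. Qed.

Lemma qmulq1 x : qmul x (qone R) = x.
Proof. by apply: quat_eqP; rewrite /qmul /qone /mkquat /qre /qi /qj /qk /=; ring. Qed.

Lemma qmulq0 x : qmul x (mkquat 0 0 0 0) = mkquat 0 0 0 0.
Proof. by apply: quat_eqP; rewrite /qmul /mkquat /qre /qi /qj /qk /=; ring. Qed.

Lemma qmul0q x : qmul (qconj (mkquat 0 0 0 0)) x = mkquat 0 0 0 0.
Proof. by apply: quat_eqP; rewrite /qmul /qconj /mkquat /qre /qi /qj /qk /=; ring. Qed.

Lemma qconj_mul x y : qconj (qmul x y) = qmul (qconj y) (qconj x).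
Proof. by apply: quat_eqP; rewrite /qmul /qconj /mkquat /qre /qi /qj /qk /=; ring. Qed.

End QuaternionDot.

(** * Positive definiteness as a real Gram condition *)

Section PositiveDefinite.
Variables (R : realType) (G : zmodType).
Implicit Types (phi psi : G -> quat R).

(** The real part of the quadratic form, arranged to be visibly real-linear in [phi]. *)
Definition gram_form phi (k : nat) (g : 'I_k -> G) (q : 'I_k -> quat R) : R :=
  \sum_(i < k) \sum_(j < k) qdot (qmul (q i) (qconj (q j))) (phi (g j - g i)).

Definition hermitian phi := forall g, phi (- g) = qconj (phi g).

Definition gram_nonneg phi := forall k g q, 0 <= @gram_form phi k g q.

(** Only the vanishing of imaginary parts is used, at the points [0] and [g]. Weights [(1, 0)] make
    [phi 0] real, [(1, 1)] cancel the imaginary parts of [phi g] and [phi (- g)], and [(1, i)]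
    equate their real parts. *)
Lemma positive_definite_hermitian phi : positive_definite phi -> hermitian phi.
Proof.
move=> pd g.
have two (a b : quat R) :
    let s c := c (qmul (qmul (qconj a) (phi 0)) a) + c (qmul (qmul (qconj a) (phi g)) b) +
               (c (qmul (qmul (qconj b) (phi (- g))) a) + c (qmul (qmul (qconj b) (phi 0)) b)) in
    [/\ s (@qi R) = 0, s (@qj R) = 0 & s (@qk R) = 0].
  have := pd 2%N (fun i => nth 0 [:: 0; g] i) (fun i => nth a [:: a; b] i).
  rewrite /qsum /mkquat {1}/qi {1}/qj {1}/qk /= !big_ord_recl !big_ord0 /=.
  by rewrite !addr0 !subrr !subr0 !sub0r => -[].
have := two (qone R) (mkquat 0 0 0 0); have := two (qone R) (qone R).
have := two (qone R) (mkquat 0 1 0 0).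
rewrite !qmulq0 !qmul0q !qmul1q !qmulq1 /=.
move: (phi 0) (phi g) (phi (- g)) => {pd two}.
move=> [[[x1 x2] x3] x4] [[[y1 y2] y3] y4] [[[z1 z2] z3] z4] [re1 _ _] [i1 j1 k1] [i0 j0 k0].
move: re1 i1 j1 k1 i0 j0 k0.
rewrite /qmul /qconj /mkquat /qre /qi /qj /qk /= => re1 i1 j1 k1 i0 j0 k0.
congr (_, _, _, _).
- by move: i0 re1; clear; lra.
- by move: i0 i1; clear; lra.
- by move: j0 j1; clear; lra.
- by move: k0 k1; clear; lra.
Qed.

(** For the converse, exchanging [i] and [j] conjugates the terms, so each imaginary component of
    the sum is its own negative. *)
Lemma positive_definiteP phi :
  positive_definite phi <-> hermitian phi /\ gram_nonneg phi.
Proof.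
split=> [pd|[herm gram] k g q s].
  split; first exact: positive_definite_hermitian.
  move=> k g q; have [_ _ _] := pd k g q; rewrite /qsum /mkquat {1}/qre /=.
  congr (0 <= _); apply: eq_bigr => i _; apply: eq_bigr => j _.
  exact: qdot_sandwich.
pose F i j := qmul (qmul (qconj (q i)) (phi (g j - g i))) (q j).
have sym i j : F j i = qconj (F i j).
  rewrite /F !qconj_mul qconjK -herm opprB.
  by apply: quat_eqP; rewrite /qmul /qconj /mkquat /qre /qi /qj /qk /=; ring.
have vanish (c : quat R -> R) : (forall x, c (qconj x) = - c x) ->
    \sum_(i < k) \sum_(j < k) c (F i j) = 0.
  move=> cN; set t := LHS.
  suff : t = - t by lra.
  rewrite /t [LHS]exchange_big /= -sumrN; apply: eq_bigr => i _.
  by rewrite -sumrN; apply: eq_bigr => j _; rewrite sym cN.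
split; rewrite /s /qsum /mkquat /=.
- exact: (@vanish (@qi R)).
- exact: (@vanish (@qj R)).
- exact: (@vanish (@qk R)).
have := gram k g q; congr (0 <= _).
by apply: eq_bigr => i _; apply: eq_bigr => j _; rewrite -qdot_sandwich.
Qed.

Lemma hermitian0 phi : hermitian phi -> phi 0 = mkquat (qre (phi 0)) 0 0 0.
Proof.
move=> /(_ 0); rewrite oppr0 => e.
have := congr1 (@qi R) e; have := congr1 (@qj R) e; have := congr1 (@qk R) e.
rewrite /qconj /mkquat /qre /qi /qj /qk /= => h1 h2 h3.
by apply: quat_eqP; rewrite /qre /qi /qj /qk /=; lra.
Qed.

Lemma gram_value0_ge0 phi : gram_nonneg phi -> 0 <= qre (phi 0).
Proof.
move=> /(_ 1%N (fun=> 0) (fun=> mkquat 1 0 0 0)).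
rewrite /gram_form !big_ord_recl !big_ord0 !addr0 subrr.
by rewrite /qdot /qmul /qconj /mkquat /qre /qi /qj /qk /=; lra.
Qed.

(** With [r = qre (phi 0)] and [n = qnorm2 (phi g)], the points [0], [g] with weights [1] and [- t]
    times the conjugate of [phi g] give [0 <= r * (1 + t ^+ 2 * n) - 2 * t * n]. Then [t = r^-1]
    yields the bound, and [t = 1] does if [r = 0]. *)
Lemma gram_value_le phi g : hermitian phi -> gram_nonneg phi ->
  qnorm2 (phi g) <= qre (phi 0) ^+ 2.
Proof.
move=> herm gram; have h0 := hermitian0 herm; have r0 := gram_value0_ge0 gram.
have pos t : 0 <= qre (phi 0) * (1 + t ^+ 2 * qnorm2 (phi g)) - 2 * t * qnorm2 (phi g).
  have := gram 2%N (fun i => nth 0 [:: 0; g] i)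
    (fun i => nth (mkquat 1 0 0 0) [:: mkquat 1 0 0 0;
       mkquat (- t * qre (phi g)) (t * qi (phi g)) (t * qj (phi g)) (t * qk (phi g))] i).
  rewrite /gram_form !big_ord_recl !big_ord0 /= !addr0 !subrr !subr0 !sub0r herm h0.
  rewrite /qdot /qmul /qconj /qnorm2 /mkquat /qre /qi /qj /qk /=.
  by congr (0 <= _); ring.
have n0 : 0 <= qnorm2 (phi g) by rewrite /qnorm2 !addr_ge0// sqr_ge0.
move: (qre (phi 0)) (qnorm2 (phi g)) pos r0 n0 => r n pos r0 n0.
have [r_eq0|rn0] := eqVneq r 0.
  by have := pos 1; rewrite r_eq0; nra.
have rp : 0 < r by rewrite lt_neqAle eq_sym rn0.
have := pos r^-1.
have -> : r * (1 + r^-1 ^+ 2 * n) - 2 * r^-1 * n = r^-1 * (r ^+ 2 - n) by field.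
by rewrite pmulr_rge0 ?invr_gt0// subr_ge0.
Qed.

(* The form of [phi] at the [2k] points [g_i], [g_i + a] with weights [q_i], [e q_i]. *)
Lemma gram_translate phi (e : R) (a : G) k (g : 'I_k -> G) (q : 'I_k -> quat R) :
  gram_nonneg phi -> `|e| = 1 ->
  0 <= gram_form phi g q + e * 2^-1 *
    (gram_form (fun x => phi (x + a)) g q + gram_form (fun x => phi (x - a)) g q).
Proof.
move=> gram e1.
have ee : e * e = 1 by rewrite -expr2 -real_normK ?num_real// e1 expr1n.
pose g' (i : 'I_(k + k)) := match fintype.split i with inl i => g i | inr i => g i + a end.
pose sq (x : quat R) : quat R := mkquat (e * qre x) (e * qi x) (e * qj x) (e * qk x).
pose q' (i : 'I_(k + k)) := match fintype.split i with inl i => q i | inr i => sq (q i) end.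
have sl i : fintype.split (lshift k i) = inl i :> 'I_k + 'I_k by exact: (unsplitK (inl i)).
have sr i : fintype.split (rshift k i) = inr i :> 'I_k + 'I_k by exact: (unsplitK (inr i)).
have := gram _ g' q'; rewrite /gram_form big_split_ord /=.
set A := (X in 0 <= X + _); set B := (X in 0 <= _ + X).
have -> : A = \sum_(i < k) \sum_(j < k) qdot (qmul (q i) (qconj (q j))) (phi (g j - g i)) +
   e * \sum_(i < k) \sum_(j < k) qdot (qmul (q i) (qconj (q j))) (phi (g j - g i + a)).
  rewrite mulr_sumr -big_split; apply: eq_bigr => i _ /=.
  rewrite big_split_ord mulr_sumr /=; congr (_ + _); apply: eq_bigr => j _.
    by rewrite /g' /q' !sl.
  rewrite /g' /q' !sl !sr addrAC.
  by rewrite /qdot /qmul /qconj /sq /mkquat /qre /qi /qj /qk /=; ring.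
have -> : B = \sum_(i < k) \sum_(j < k) qdot (qmul (q i) (qconj (q j))) (phi (g j - g i)) +
   e * \sum_(i < k) \sum_(j < k) qdot (qmul (q i) (qconj (q j))) (phi (g j - g i - a)).
  rewrite mulr_sumr -big_split; apply: eq_bigr => i _ /=.
  rewrite big_split_ord mulr_sumr /= [LHS]addrC; congr (_ + _); apply: eq_bigr => j _.
    rewrite /g' /q' !sr opprD addrACA subrr addr0.
    rewrite -[LHS]mul1r -ee.
    by rewrite /qdot /qmul /qconj /sq /mkquat /qre /qi /qj /qk /=; ring: ee.
  rewrite /g' /q' !sl !sr opprD addrA.
  by rewrite /qdot /qmul /qconj /sq /mkquat /qre /qi /qj /qk /=; ring.
move=> h; lra.
Qed.

End PositiveDefinite.

(** * D'Alembert's functional equation *)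

Section DAlembert.
Variables (R : realType) (G : zmodType) (C : G -> R).
Hypothesis C0 : C 0 = 1.
Hypothesis C_dalembert : forall g a, C (g + a) + C (g - a) = 2 * C a * C g.

(** For [C = cos] this is minus the product of the sines of [g] and [h]. *)
Definition cosine_defect g h := C (g + h) - C g * C h.
Local Notation E := cosine_defect.

(** A rank-one identity: each defect is [(C (g + h) - C (g - h)) / 2], and the equation expands the
    products on both sides into the same values of [C]. *)
Lemma cosine_defect_mul g h k : E g h * E k k = E g k * E h k.
Proof.
have gh := C_dalembert g h; have kk := C_dalembert k k.
have gk := C_dalembert g k; have hk := C_dalembert h k.
have p1 := C_dalembert (g + h) (k + k); have p2 := C_dalembert (g - h) (k + k).
have q1 := C_dalembert (g + k) (h + k); have q2 := C_dalembert (g + k) (h - k).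
have q3 := C_dalembert (g - k) (h + k); have q4 := C_dalembert (g - k) (h - k).
rewrite (addrACA g k h k) opprD (addrACA g k (- h)) subrr addr0 in q1.
rewrite (addrACA g k h) subrr addr0 opprB (addrC k (- h)) (addrACA g k (- h)) in q2.
rewrite (addrACA g (- k) h) addNr addr0 opprD (addrACA g (- k) (- h)) -opprD in q3.
rewrite (addrACA g (- k) h) -opprD opprB (addrC k (- h)) (addrACA g (- k) (- h)) in q4.
rewrite addNr addr0 in q4.
rewrite subrr C0 in kk.
have -> : E g h = (C (g + h) - C (g - h)) / 2 by rewrite /E; lra.
have -> : E k k = (C (k + k) - 1) / 2 by rewrite /E; lra.
have -> : E g k = (C (g + k) - C (g - k)) / 2 by rewrite /E; lra.
have -> : E h k = (C (h + k) - C (h - k)) / 2 by rewrite /E; lra.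
by clear gh kk gk hk; lra.
Qed.

(** The addition formula of the sine, the role of which is played by [E _ k] for fixed [k]. *)
Lemma cosine_defect_add g h k : E (g + h) k = E g k * C h + C g * E h k.
Proof.
have p1 := C_dalembert (g + k) h; have p2 := C_dalembert g (h + k).
have p3 := congr1 (fun x => x * C k) (C_dalembert g h).
have p4 := C_dalembert (g - h) k.
rewrite addrAC (addrAC g k (- h)) in p1; rewrite addrA opprD addrA in p2.
by rewrite /E; rewrite /= in p3; lra.
Qed.

Lemma cosine_even g : C (- g) = C g.
Proof. by have := C_dalembert 0 g; rewrite C0 add0r sub0r; lra. Qed.

Section Sine.
Variable S : G -> R.
Hypothesis S_odd : forall g, S (- g) = - S g.
Hypothesis S_dalembert : forall g a, S (g + a) + S (g - a) = 2 * C a * S g.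

(** Adding the equations for [(g, h)] and [(h, g)] cancels the differences, by oddness. *)
Lemma sine_add g h : S (g + h) = C h * S g + C g * S h.
Proof.
have := S_dalembert g h; have := S_dalembert h g.
by rewrite (addrC h g) -(opprB g h) S_odd; lra.
Qed.

(** Compare the expansions of [S (g + h + k)] along the two bracketings. *)
Lemma sine_defect g h k : E g h * S k = E h k * S g.
Proof.
have := sine_add (g + h) k; have := sine_add g (h + k).
by rewrite addrA !(sine_add g h) !(sine_add h k) /E => ->; lra.
Qed.

End Sine.

(* Away from the case [C = +-1], the sine is read off a single [g0] with [C g0 ^+ 2 < 1]. *)
Lemma dalembert_dichotomy : (forall g, C g ^+ 2 <= 1) ->
  (forall g, C g ^+ 2 = 1) \/
  exists g0 s0 (s : G -> R), [/\ 0 < s0, s0 ^+ 2 = 1 - C g0 ^+ 2,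
    forall g, C g ^+ 2 + s g ^+ 2 = 1,
    (forall g h, C (g + h) = C g * C h - s g * s h) /\
    (forall g h, s (g + h) = s g * C h + C g * s h) &
    forall S : G -> R, (forall g, S (- g) = - S g) ->
      (forall g a, S (g + a) + S (g - a) = 2 * C a * S g) ->
      forall g, S g = s g * (S g0 / s0)].
Proof.
move=> C1; have [|/existsNP[g0 /eqP g0N]] := pselect (forall g, C g ^+ 2 = 1); first by left.
right; have C_lt : C g0 ^+ 2 < 1 by rewrite lt_neqAle g0N C1.
(* Here [s0] stands for the sine at [g0], chosen positive; as [E g g0] models [- s g * s0], division
   recovers [s]. *)
pose s0 := Num.sqrt (1 - C g0 ^+ 2); pose s g := - E g g0 / s0.
have s0p : 0 < s0 by rewrite sqrtr_gt0 subr_gt0.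
have s02 : s0 ^+ 2 = 1 - C g0 ^+ 2 by rewrite sqr_sqrtr// subr_ge0 C1.
have Eg0 : E g0 g0 = - s0 ^+ 2.
  by have := C_dalembert g0 g0; rewrite subrr C0 s02 /E expr2; lra.
have sE g : E g g0 = - s0 * s g by rewrite /s; field; rewrite gt_eqF.
have mulE g h : E g h = - (s g * s h).
  have := cosine_defect_mul g h g0; rewrite Eg0 !sE => e.
  have sq0 : s0 ^+ 2 != 0 by rewrite expf_neq0// gt_eqF.
  by apply: (mulIf sq0); lra.
have Cadd g h : C (g + h) = C g * C h - s g * s h by have := mulE g h; rewrite /E; lra.
have s_odd g : s (- g) = - s g.
  rewrite /s /E cosine_even -(cosine_even (- g + g0)) opprD opprK -[RHS]mulNr.
  by congr (_ / _); have := C_dalembert g g0; lra.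
exists g0, s0, s; split=> //.
- by move=> g; have := Cadd g (- g); rewrite subrr C0 s_odd cosine_even; lra.
- split=> // g h; rewrite /s cosine_defect_add; field; exact: lt0r_neq0.
(* Taking both [h] and [k] to be [g0] in [sine_defect] makes [S] a multiple of [E _ g0], hence of
   [s]. *)
move=> S S_odd SdA g; have := sine_defect S_odd SdA g g0 g0.
rewrite Eg0 sE => e.
have sn : s0 != 0 by rewrite gt_eqF.
have : s0 ^+ 2 * S g = s0 ^+ 2 * (s g * (S g0 / s0)).
  have -> : s0 ^+ 2 * (s g * (S g0 / s0)) = s0 * s g * S g0 by field.
  lra.
by apply: mulfI; rewrite expf_neq0.
Qed.

End DAlembert.

(** * Solutions of the d'Alembert equation as averages of two characters *)

Section ExtremeForm.
Variables (R : realType) (G : zmodType) (phi : G -> quat R).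
Hypothesis phi0 : phi 0 = qone R.
Hypothesis phi_herm : hermitian phi.
Hypothesis phi_le1 : forall g, qnorm2 (phi g) <= 1.
Hypothesis phi_dalembert : forall c g a,
  qdot c (phi (g + a)) + qdot c (phi (g - a)) = 2 * qre (phi a) * qdot c (phi g).

(** If [C ^+ 2 = 1] everywhere, the norm bound kills the imaginary parts and [phi] is a character
    with values [1] and [-1]. Otherwise each imaginary component is odd, hence a multiple of [s];
    with [w = r * u] and [u] a unit vector, the weights on [C + s u] and [C - s u] are [(1 + r) / 2]
    and [(1 - r) / 2]. *)
Lemma dalembert_average_chars : exists (t : R) (g1 g2 : G -> quat R),
  [/\ 0 <= t <= 1, qchars g1, qchars g2 & forall c g,
    qdot c (phi g) = t * qdot c (g1 g) + (1 - t) * qdot c (g2 g)].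
Proof.
pose C g := qre (phi g).
have CdA g a : C (g + a) + C (g - a) = 2 * C a * C g.
  have := phi_dalembert (mkquat 1 0 0 0) g a.
  by rewrite /C /qdot /mkquat /qre /qi /qj /qk /=; lra.
have C0 : C 0 = 1 by rewrite /C phi0.
have sq (x : R) : 0 <= x ^+ 2 by exact: sqr_ge0.
have C1 g : C g ^+ 2 <= 1.
  have := phi_le1 g; rewrite /qnorm2 -/(C g).
  have := sq (qi (phi g)); have := sq (qj (phi g)); have := sq (qk (phi g)); lra.
have [Csq|[g0 [s0 [s [s0p s02 Cs [Cadd sadd] Sform]]]]] := dalembert_dichotomy C0 CdA C1.
  suff ch : qchars phi by exists 1, phi, phi; split; rewrite ?ler01 ?lexx// => c g; lra.
  have im g : [/\ qi (phi g) = 0, qj (phi g) = 0 & qk (phi g) = 0].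
    have := phi_le1 g; rewrite /qnorm2 -/(C g) Csq.
    have := sq (qi (phi g)); have := sq (qj (phi g)); have := sq (qk (phi g)).
    by move=> h1 h2 h3 h4; split; apply/eqP; rewrite -sqrf_eq0; apply/eqP; lra.
  split=> [g|g h].
    by rewrite /qnorm2 -/(C g) Csq; have [-> -> ->] := im g; rewrite expr0n /= !addr0.
  have Cm : C (g + h) = C g * C h.
    have := CdA g h; have := Csq (g + h); have := Csq (g - h).
    have := Csq g; have := Csq h.
    move: (C g) (C h) (C (g + h)) (C (g - h)) => x y u v.
    rewrite !expr2 => y1 x1 v1 u1 uv.
    (* From [u ^+ 2 = v ^+ 2] and [u + v = 2 * x * y] comes [(u - v) * x * y = 0]; as [x] and [y]
       square to [1], [u = v = x * y]. *)
    have uvx : (u - v) * (x * y) = 0.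
      have : (u - v) * (u + v) = 0 by lra.
      by rewrite uv; lra.
    have : (u - v) * (x * x) * (y * y) = 0 by rewrite -[RHS](mul0r (x * y)) -uvx; ring.
    by rewrite x1 y1; lra.
  have [i1 j1 k1] := im g; have [i2 j2 k2] := im h; have [i3 j3 k3] := im (g + h).
  apply: quat_eqP; rewrite ?i3 ?j3 ?k3.
  - have -> : qre (qmul (phi g) (phi h)) = C g * C h - qi (phi g) * qi (phi h)
      - qj (phi g) * qj (phi h) - qk (phi g) * qk (phi h) by [].
    by rewrite i1 j1 k1 -Cm; lra.
  - have -> : qi (qmul (phi g) (phi h)) = C g * qi (phi h) + qi (phi g) * C h
      + qj (phi g) * qk (phi h) - qk (phi g) * qj (phi h) by [].
    by rewrite i1 j1 k1 i2; lra.
  - have -> : qj (qmul (phi g) (phi h)) = C g * qj (phi h) - qi (phi g) * qk (phi h)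
      + qj (phi g) * C h + qk (phi g) * qi (phi h) by [].
    by rewrite i1 j1 k1 j2; lra.
  - have -> : qk (qmul (phi g) (phi h)) = C g * qk (phi h) + qi (phi g) * qj (phi h)
      - qj (phi g) * qi (phi h) + qk (phi g) * C h by [].
    by rewrite i1 j1 k1 k2; lra.
have odd (c : quat R -> R) : (forall x, c (qconj x) = - c x) ->
  forall g, c (phi (- g)) = - c (phi g) by move=> cN g; rewrite phi_herm cN.
have dA c : forall g a, qdot c (phi (g + a)) + qdot c (phi (g - a)) = 2 * C a * qdot c (phi g).
  exact: phi_dalembert.
have qiE x : qi x = qdot (mkquat 0 1 0 0) x :> R.
  by rewrite /qdot /mkquat /qre /qi /qj /qk /=; lra.
have qjE x : qj x = qdot (mkquat 0 0 1 0) x :> R.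
  by rewrite /qdot /mkquat /qre /qi /qj /qk /=; lra.
have qkE x : qk x = qdot (mkquat 0 0 0 1) x :> R.
  by rewrite /qdot /mkquat /qre /qi /qj /qk /=; lra.
have fi g : qi (phi g) = s g * (qi (phi g0) / s0).
  by apply: (Sform (fun g => qi (phi g))); [exact: odd|move=> ? ?; rewrite !qiE].
have fj g : qj (phi g) = s g * (qj (phi g0) / s0).
  by apply: (Sform (fun g => qj (phi g))); [exact: odd|move=> ? ?; rewrite !qjE].
have fk g : qk (phi g) = s g * (qk (phi g0) / s0).
  by apply: (Sform (fun g => qk (phi g))); [exact: odd|move=> ? ?; rewrite !qkE].
move: fi fj fk; set w1 := _ / s0; set w2 := qj _ / s0; set w3 := qk _ / s0 => fi fj fk.
(* At [g0] the squared norm of the imaginary part is at most [1 - C g0 ^+ 2 = s0 ^+ 2]. *)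
have w1le : w1 ^+ 2 + w2 ^+ 2 + w3 ^+ 2 <= 1.
  rewrite /w1 /w2 /w3 !expr_div_n -!mulrDl ler_pdivrMr ?exprn_gt0// mul1r s02.
  by have := phi_le1 g0; rewrite /qnorm2 -/(C g0); lra.
move: w1 w2 w3 fi fj fk w1le => w1 w2 w3 fi fj fk w1le.
have [r [u1 [u2 [u3 [r01 u1sq [e1 e2 e3]]]]]] : exists r u1 u2 u3 : R,
    [/\ 0 <= r <= 1, u1 ^+ 2 + u2 ^+ 2 + u3 ^+ 2 = 1 &
     [/\ w1 = r * u1, w2 = r * u2 & w3 = r * u3]].
  pose n := w1 ^+ 2 + w2 ^+ 2 + w3 ^+ 2; have n0 : 0 <= n by rewrite /n !addr_ge0.
  have [nz|nN0] := eqVneq n 0.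
    (* If [w = 0] any unit direction serves, with [r = 0]. *)
    exists 0, 1, 0, 0; split; [by rewrite lexx ler01|by rewrite !expr2; lra|].
    have := sq w1; have := sq w2; have := sq w3 => h3 h2 h1.
    by split; rewrite mul0r; apply/eqP; rewrite -sqrf_eq0; apply/eqP; move: nz; rewrite /n; lra.
  have np : 0 < n by rewrite lt_neqAle eq_sym nN0.
  pose r := Num.sqrt n; have rp : 0 < r by rewrite sqrtr_gt0.
  have r2 : r ^+ 2 = n by rewrite sqr_sqrtr.
  have rN0 : r != 0 by rewrite gt_eqF.
  exists r, (w1 / r), (w2 / r), (w3 / r); split.
  - by rewrite ltW//=; move: r2 w1le rp; rewrite -/n expr2 => <- r1 rp; nra.
  - by rewrite !expr_div_n -!mulrDl r2 -/n divff.
  - by split; field.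
(* The imaginary unit [u] squares to [-1], so for [e] equal to [1] or [-1] this is the complex
   character [C + i e s] inside a copy of the complex numbers. *)
pose ga (e : R) (g : G) : quat R := mkquat (C g) (e * s g * u1) (e * s g * u2) (e * s g * u3).
have gach e : e * e = 1 -> qchars (ga e).
  move=> ee; split=> [g|g h].
    rewrite /qnorm2 /ga /mkquat /qre /qi /qj /qk /=.
    transitivity (C g ^+ 2 + e * e * s g ^+ 2 * (u1 ^+ 2 + u2 ^+ 2 + u3 ^+ 2)).
      by ring.
    by rewrite ee u1sq mulr1 mul1r Cs.
  have ss : (e * s g * u1) * (e * s h * u1) + (e * s g * u2) * (e * s h * u2) +
      (e * s g * u3) * (e * s h * u3) = s g * s h.
    have -> : s g * s h = (e * e) * (s g * s h) * (u1 ^+ 2 + u2 ^+ 2 + u3 ^+ 2).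
      by rewrite ee u1sq; ring.
    by ring.
  apply: quat_eqP; rewrite /ga /qmul /mkquat /qre /qi /qj /qk /= ?Cadd ?sadd; last 3 first.
  - by ring.
  - by ring.
  - by ring.
  by rewrite -ss; ring.
exists ((1 + r) / 2), (ga 1), (ga (-1)); split.
- by move: r01; lra.
- by apply: gach; ring.
- by apply: gach; ring.
move=> c g; rewrite /qdot fi fj fk -/(C g) e1 e2 e3 /ga /mkquat /qre /qi /qj /qk /=.
by field.
Qed.

End ExtremeForm.

(** * Real combinations and trigonometric polynomials *)

Section QuaternionCombination.
Variable R : realType.
Implicit Types c x y z : quat R.

(** Three terms, to combine [f g], [f (g + a)] and [f (g - a)]; zero coefficients give shorter
    combinations. *)
Definition qcomb (r s t : R) x y z : quat R :=
  mkquat (r * qre x + s * qre y + t * qre z) (r * qi x + s * qi y + t * qi z)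
         (r * qj x + s * qj y + t * qj z) (r * qk x + s * qk y + t * qk z).

Lemma qdot_comb c r s t x y z :
  qdot c (qcomb r s t x y z) = r * qdot c x + s * qdot c y + t * qdot c z.
Proof. by rewrite /qdot /qcomb /mkquat /qre /qi /qj /qk /=; ring. Qed.

Lemma qconj_comb r s t x y z :
  qconj (qcomb r s t x y z) = qcomb r s t (qconj x) (qconj y) (qconj z).
Proof.
by apply: quat_eqP; rewrite /qconj /qcomb /mkquat /qre /qi /qj /qk /=; ring.
Qed.

Lemma qmulA x y z : qmul x (qmul y z) = qmul (qmul x y) z.
Proof. by apply: quat_eqP; rewrite /qmul /mkquat /qre /qi /qj /qk /=; ring. Qed.

Lemma qmul1x x : qmul (qone R) x = x.
Proof. by apply: quat_eqP; rewrite /qmul /qone /mkquat /qre /qi /qj /qk /=; ring. Qed.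

Lemma qmul_conjl x : qnorm2 x = 1 -> qmul (qconj x) x = qone R.
Proof.
rewrite /qnorm2 => x1; apply: quat_eqP;
  rewrite /qmul /qconj /qone /mkquat /qre /qi /qj /qk /=;
  [rewrite -[RHS]x1 /qre /qi /qj /qk| | |]; by ring.
Qed.

Lemma qdot_conj_mul x y p r :
  qdot (qmul x (qconj y)) (qmul (qconj p) r) = qdot (qmul p x) (qmul r y).
Proof. by rewrite /qdot /qmul /qconj /mkquat /qre /qi /qj /qk /=; ring. Qed.

End QuaternionCombination.

Section TrigPolynomials.
Variables (R : realType) (G : zmodType).

(* [t = (c, g)] stands for the real-linear function [f |-> Re (conj c * f g)]. *)
Definition trig (s : seq (quat R * G)) (f : G -> quat R) : R :=
  \sum_(t <- s) qdot t.1 (f t.2).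

Lemma trig1 c g f : trig [:: (c, g)] f = qdot c (f g).
Proof. by rewrite /trig big_seq1. Qed.

Lemma trig_cat s t f : trig (s ++ t) f = trig s f + trig t f.
Proof. by rewrite /trig big_cat. Qed.

Definition trig_scale (r : R) (s : seq (quat R * G)) :=
  [seq (qcomb r 0 0 t.1 t.1 t.1, t.2) | t <- s].

Lemma trig_scaleE r s f : trig (trig_scale r s) f = r * trig s f.
Proof.
rewrite /trig big_map mulr_sumr; apply: eq_bigr => t _ /=.
by rewrite qdotC qdot_comb qdotC; lra.
Qed.

Lemma trig_comb s (r1 r2 r3 : R) (f1 f2 f3 : G -> quat R) :
  trig s (fun g => qcomb r1 r2 r3 (f1 g) (f2 g) (f3 g)) =
  r1 * trig s f1 + r2 * trig s f2 + r3 * trig s f3.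
Proof.
rewrite /trig !mulr_sumr -!big_split; apply: eq_bigr => t _ /=.
by rewrite qdot_comb.
Qed.

Definition gram_seq k (g : 'I_k -> G) (q : 'I_k -> quat R) :=
  [seq (qmul (q i) (qconj (q j)), g j - g i) |
     i <- index_enum 'I_k, j <- index_enum 'I_k].

Lemma gram_trig phi k (g : 'I_k -> G) (q : 'I_k -> quat R) :
  gram_form phi g q = trig (gram_seq g q) phi.
Proof. by rewrite /trig /gram_seq big_allpairs_dep. Qed.

Lemma gram_comb k (g : 'I_k -> G) (q : 'I_k -> quat R) (r1 r2 r3 : R) (f1 f2 f3 : G -> quat R) :
  gram_form (fun g => qcomb r1 r2 r3 (f1 g) (f2 g) (f3 g)) g q =
  r1 * gram_form f1 g q + r2 * gram_form f2 g q + r3 * gram_form f3 g q.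
Proof. by rewrite !gram_trig trig_comb. Qed.

End TrigPolynomials.

(** * Characters as positive definite functions *)

Section Characters.
Variables (R : realType) (G : zmodType) (gamma : G -> quat R).
Hypothesis gammaP : @qchars R G gamma.

Lemma qchar0 : gamma 0 = qone R.
Proof.
have [n1 mulg] := gammaP; have := mulg 0 0; rewrite addr0 => e.
have := congr1 (qmul (qconj (gamma 0))) e.
by rewrite qmulA qmul_conjl// qmul1x => <-.
Qed.

Lemma qcharN g : gamma (- g) = qconj (gamma g).
Proof.
have [n1 mulg] := gammaP; have := mulg g (- g); rewrite subrr qchar0 => e.
have := congr1 (qmul (qconj (gamma g))) e.
by rewrite qmulA qmul_conjl// qmul1x qmulq1.
Qed.

Lemma qchar_gram : gram_nonneg gamma.
Proof.
have [n1 mulg] := gammaP => k g q; pose y i := qmul (gamma (g i)) (q i).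
have -> : gram_form gamma g q = (\sum_i qre (y i)) ^+ 2 + (\sum_i qi (y i)) ^+ 2 +
    (\sum_i qj (y i)) ^+ 2 + (\sum_i qk (y i)) ^+ 2.
  rewrite !expr2 !big_distrlr /= -!big_split; apply: eq_bigr => i _ /=.
  rewrite -!big_split; apply: eq_bigr => j _ /=.
  by rewrite (addrC (g j) (- g i)) mulg qcharN qdot_conj_mul.
by rewrite !addr_ge0// sqr_ge0.
Qed.

(** Cauchy-Schwarz for unit vectors, from the squared norms of [c + x] and [c - x] being
    nonnegative. *)
Lemma qchar_qdot_le1 c g : qnorm2 c = 1 -> `|qdot c (gamma g)| <= 1.
Proof.
have [/(_ g) n1 _] := gammaP => c1; move: n1 c1; rewrite /qnorm2 /qdot.
move: (qre c) (qi c) (qj c) (qk c) => c0 c1 c2 c3.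
move: (qre _) (qi _) (qj _) (qk _) => x0 x1 x2 x3 xn cn.
have := sqr_ge0 (c0 - x0); have := sqr_ge0 (c1 - x1).
have := sqr_ge0 (c2 - x2); have := sqr_ge0 (c3 - x3).
have := sqr_ge0 (c0 + x0); have := sqr_ge0 (c1 + x1).
have := sqr_ge0 (c2 + x2); have := sqr_ge0 (c3 + x3).
by rewrite ler_norml => *; apply/andP; split; lra.
Qed.

End Characters.

(** * Topology of pointwise convergence and compactness of the dual *)

Section RealContinuity.
Variables (R : realType) (T : topologicalType).
Implicit Types u v : T -> R.

Lemma real_continuousD u v : continuous u -> continuous v ->
  continuous (fun x => u x + v x).
Proof. by move=> cu cv x; apply: cvgD; [exact: cu|exact: cv]. Qed.

Lemma real_continuousB u v : continuous u -> continuous v ->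
  continuous (fun x => u x - v x).
Proof. by move=> cu cv x; apply: cvgB; [exact: cu|exact: cv]. Qed.

Lemma real_continuousM u v : continuous u -> continuous v ->
  continuous (fun x => u x * v x).
Proof. by move=> cu cv x; apply: cvgM; [exact: cu|exact: cv]. Qed.

Lemma closed_eqfun u v : continuous u -> continuous v -> closed [set x | u x = v x].
Proof.
move=> cu cv.
rewrite (_ : [set x | u x = v x] = (fun x => u x - v x) @^-1` [set 0]).
  apply: closed_comp; last exact: closed_eq.
  by move=> x _; exact: real_continuousB.
by apply/seteqP; split=> x /=; lra.
Qed.

End RealContinuity.

Section PointwiseTopology.
Variables (R : realType) (G : zmodType).
Local Notation X := {ptws G -> quat R}.

Lemma eval_continuous (g : G) : continuous (fun f : X => f g).
Proof. by move=> f; exact: (@proj_continuous G (fun=> quat R) g). Qed.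

Lemma qre_eval_continuous g : continuous (fun f : X => qre (f g)).
Proof.
move=> f; apply: (@continuous_comp X _ _ (fun f : X => f g) (@qre R)); first exact: eval_continuous.
apply: (@continuous_comp _ _ _ fst (fun x => x.1.1)); first exact: cvg_fst.
apply: (@continuous_comp _ _ _ fst fst); exact: cvg_fst.
Qed.

Lemma qi_eval_continuous g : continuous (fun f : X => qi (f g)).
Proof.
move=> f; apply: (@continuous_comp X _ _ (fun f : X => f g) (@qi R)); first exact: eval_continuous.
apply: (@continuous_comp _ _ _ fst (fun x => x.1.2)); first exact: cvg_fst.
by apply: (@continuous_comp _ _ _ fst snd); [exact: cvg_fst|exact: cvg_snd].
Qed.

Lemma qj_eval_continuous g : continuous (fun f : X => qj (f g)).
Proof.
move=> f; apply: (@continuous_comp X _ _ (fun f : X => f g) (@qj R)); first exact: eval_continuous.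
by apply: (@continuous_comp _ _ _ fst snd); [exact: cvg_fst|exact: cvg_snd].
Qed.

Lemma qk_eval_continuous g : continuous (fun f : X => qk (f g)).
Proof.
move=> f; apply: (@continuous_comp X _ _ (fun f : X => f g) (@qk R)); first exact: eval_continuous.
exact: cvg_snd.
Qed.

Lemma qdot_eval_continuous c g : continuous (fun f : X => qdot c (f g)).
Proof.
apply: real_continuousD; [apply: real_continuousD; [apply: real_continuousD|]|]; apply: real_continuousM; try exact: cst_continuous.
- exact: qre_eval_continuous.
- exact: qi_eval_continuous.
- exact: qj_eval_continuous.
- exact: qk_eval_continuous.
Qed.

Lemma trig_continuous s : continuous (trig s : X -> R).
Proof.
elim: s => [|[c g] s IH].
  rewrite (_ : trig [::] = fun=> 0); first exact: cst_continuous.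
  by apply/funext => f; rewrite /trig big_nil.
rewrite (_ : trig _ = fun f => qdot c (f g) + trig s f); last first.
  by apply/funext => f; rewrite /trig big_cons.
by apply: real_continuousD => //; exact: qdot_eval_continuous.
Qed.

Lemma qnorm2_eval_continuous g : continuous (fun f : X => qnorm2 (f g)).
Proof.
rewrite (_ : (fun f : X => qnorm2 (f g)) = fun f => qre (f g) * qre (f g) +
  qi (f g) * qi (f g) + qj (f g) * qj (f g) + qk (f g) * qk (f g)); last first.
  by apply/funext => f; rewrite /qnorm2 !expr2.
have [r1 i1] := (@qre_eval_continuous g, @qi_eval_continuous g).
have [j1 k1] := (@qj_eval_continuous g, @qk_eval_continuous g).
by do 3 (apply: real_continuousD; last exact: real_continuousM); exact: real_continuousM.
Qed.

Lemma qdot_mul_eval_continuous c g h :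
  continuous (fun f : X => qdot c (qmul (f g) (f h))).
Proof.
have D := @real_continuousD R X; have B := @real_continuousB R X.
have M := @real_continuousM R X.
have [r1 r2] := (@qre_eval_continuous g, @qre_eval_continuous h).
have [i1 i2] := (@qi_eval_continuous g, @qi_eval_continuous h).
have [j1 j2] := (@qj_eval_continuous g, @qj_eval_continuous h).
have [k1 k2] := (@qk_eval_continuous g, @qk_eval_continuous h).
have cst a : continuous (fun _ : X => a : R) by exact: cst_continuous.
exact (D _ _ (D _ _ (D _ _
  (M _ _ (cst (qre c))
     (B _ _ (B _ _ (B _ _ (M _ _ r1 r2) (M _ _ i1 i2)) (M _ _ j1 j2)) (M _ _ k1 k2)))
  (M _ _ (cst (qi c))
     (B _ _ (D _ _ (D _ _ (M _ _ r1 i2) (M _ _ i1 r2)) (M _ _ j1 k2)) (M _ _ k1 j2))))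
  (M _ _ (cst (qj c))
     (D _ _ (D _ _ (B _ _ (M _ _ r1 j2) (M _ _ i1 k2)) (M _ _ j1 r2)) (M _ _ k1 i2))))
  (M _ _ (cst (qk c))
     (D _ _ (B _ _ (D _ _ (M _ _ r1 k2) (M _ _ i1 j2)) (M _ _ j1 i2)) (M _ _ k1 r2)))).
Qed.

Definition unit_box : set (quat R) :=
  [set x | (x.1.1.1 \in `[-1, 1]) /\ (x.1.1.2 \in `[-1, 1]) /\
           (x.1.2 \in `[-1, 1]) /\ (x.2 \in `[-1, 1]) ].

Lemma unit_box_compact : compact unit_box.
Proof.
have cI : compact `[-1 : R, 1] by exact: segment_compact.
have := compact_setX (compact_setX (compact_setX cI cI) cI) cI.
rewrite (_ : _ `*` _ = unit_box)//.
by apply/seteqP; split=> -[[[a b] c] d] /=; rewrite /unit_box /=; tauto.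
Qed.

Lemma unit_box_qnorm2 (x : quat R) : qnorm2 x <= 1 -> unit_box x.
Proof.
case: x => [[[a b] c] d]; rewrite /qnorm2 /unit_box /qre /qi /qj /qk /= !in_itv /=.
have := sqr_ge0 a; have := sqr_ge0 b; have := sqr_ge0 c; have := sqr_ge0 d.
by move=> *; repeat split; apply/andP; split; nra.
Qed.

(** By Tychonoff: the set is closed in a product of compact boxes. *)
Lemma bounded_closed_compact (A : set X) : closed A ->
  (forall f, A f -> forall g, qnorm2 (f g) <= 1) -> compact A.
Proof.
move=> cA Ab; apply: subclosed_compact cA _ _.
  exact: (@tychonoff G (fun=> quat R) (fun=> unit_box) (fun=> unit_box_compact)).
by move=> f Af g; apply: unit_box_qnorm2; exact: Ab.
Qed.

Lemma qchars_compact : compact (@qchars R G).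
Proof.
apply: bounded_closed_compact; last by move=> f [+ _] g => ->.
(* Testing multiplicativity against every [c] turns it into equations between continuous real
   functions. *)
rewrite (_ : @qchars R G = [set f : X | forall g, qnorm2 (f g) = 1] `&`
  [set f : X | forall gh : G * G, forall c, qdot c (f (gh.1 + gh.2)) = qdot c (qmul (f gh.1) (f gh.2))]);
  last first.
  apply/seteqP; split=> f [n1 mf]; split=> //.
    by move=> [g h] c /=; rewrite mf.
  by move=> g h; apply: qdot_inj => c; exact: (mf (g, h)).
apply: closedI.
  rewrite (_ : [set f | _] = \bigcap_g [set f : X | qnorm2 (f g) = 1]); last first.
    by apply/seteqP; split=> f h g; [move=> _|]; exact: h.
  apply: closed_bigI => g _; apply: closed_eqfun; last exact: cst_continuous.
  exact: qnorm2_eval_continuous.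
rewrite (_ : [set f | _] = \bigcap_(ghc : G * G * quat R) [set f : X |
  qdot ghc.2 (f (ghc.1.1 + ghc.1.2)) = qdot ghc.2 (qmul (f ghc.1.1) (f ghc.1.2))]); last first.
  apply/seteqP; split=> f h; first by move=> [[g g'] c] _ /=; exact: (h (g, g')).
  by move=> [g g'] c; exact: (h (g, g', c)).
apply: closed_bigI => -[[g h] c] _ /=; apply: closed_eqfun.
  exact: qdot_eval_continuous.
exact: qdot_mul_eval_continuous.
Qed.

End PointwiseTopology.

Section DualTopology.
Variables (R : realType) (G : zmodType).

(** The filter is pushed forward along the inclusion; a cluster point in [A] lifts back, as open
    sets of the subspace are preimages. *)
Lemma set_type_compact (T : topologicalType) (A : set T) :
  compact A -> compact [set: set_type A].
Proof.
move=> cA F PF _.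
have sub : [set: set_type A] `<=` set_val @^-1` A by move=> x _; exact: set_valP.
have FA : (set_val @ F) A by apply: (@filterS _ F _ _ _ sub); exact: filterT.
have [p [Ap clp]] := cA _ (fmap_proper_filter set_val PF) FA.
exists (exist _ p (mem_set Ap)); split=> // B C FB.
rewrite nbhsE => -[_ [[V oV <-] /= Vp] VC].
have FvB : (set_val @ F) (set_val @` B).
  by apply: (@filterS _ F _ _ _ _ FB) => x Bx; exists x.
have [_ [[x Bx <-] Vx]] := clp _ _ FvB (open_nbhs_nbhs (conj oV Vp)).
by exists x; split=> //; exact: VC.
Qed.

Lemma qdual_compact : compact [set: qdual R G].
Proof. exact/set_type_compact/qchars_compact. Qed.

Lemma set_val_continuous : continuous (set_val : qdual R G -> {ptws G -> quat R}).
Proof. exact: initial_continuous. Qed.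

Lemma trig_qdual_continuous s : continuous (fun x : qdual R G => trig s (set_val x)).
Proof.
move=> x; apply: (@continuous_comp _ _ _ set_val (trig s : {ptws G -> quat R} -> R)).
  exact: set_val_continuous.
exact: trig_continuous.
Qed.

(** The continuous real functions [trig s] separate points. *)
Lemma qdual_hausdorff : hausdorff_space (qdual R G).
Proof.
move=> x y xy.
suff e s : trig s (set_val x) = trig s (set_val y).
  apply/val_inj/funext => g; apply: qdot_inj => c.
  by have := e [:: (c, g)]; rewrite !trig1.
apply: (@Rhausdorff R) => A B nA nB.
have [z [Az Bz]] := xy _ _ (@trig_qdual_continuous s x _ nA) (@trig_qdual_continuous s y _ nB).
by exists (trig s (set_val z)).
Qed.

End DualTopology.

(** * The compact set of normalized positive definite functions and its extreme points *)

Section NormalizedPositiveDefinite.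
Variables (R : realType) (G : zmodType).
Local Notation X := {ptws G -> quat R}.

Definition normalized_pd : set X :=
  [set f | [/\ hermitian f, gram_nonneg f & f 0 = qone R]].

Lemma normalized_pd_closed : closed normalized_pd.
Proof.
rewrite (_ : normalized_pd =
  (\bigcap_(gc : G * quat R) [set f : X | qdot gc.2 (f (- gc.1)) = qdot (qconj gc.2) (f gc.1)])
  `&` (\bigcap_s [set f : X | (exists k g q, s = @gram_seq R G k g q) -> 0 <= trig s f])
  `&` (\bigcap_c [set f : X | qdot c (f 0) = qdot c (qone R)])); last first.
  apply/seteqP; split=> [f [herm gram f0]|f [[herm gram] f0]].
    split; [split|].
    - by move=> [g c] _ /=; rewrite herm -qdot_conj.
    - by move=> _ _ /= [k [g [q ->]]]; rewrite -gram_trig.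
    - by move=> c _ /=; rewrite f0.
  split.
  - by move=> g; apply: qdot_inj => c; have /= := herm (g, c) Logic.I; rewrite qdot_conj.
  - by move=> k g q; rewrite gram_trig; apply: (gram _ Logic.I); exists k, g, q.
  - by apply: qdot_inj => c; exact: f0.
apply: closedI; [apply: closedI|].
- apply: closed_bigI => -[g c] _ /=.
  by apply: closed_eqfun; exact: qdot_eval_continuous.
- apply: closed_bigI => s _; have [p|np] := pselect (exists k g q, s = @gram_seq R G k g q).
    rewrite (_ : [set f | _] = (trig s : X -> R) @^-1` [set r | 0 <= r]).
      by apply: closed_comp; [move=> f _; exact: trig_continuous|exact: closed_ge].
    by apply/seteqP; split=> f /=; [exact|].
  by rewrite (_ : [set f | _] = setT); [exact: closedT|apply/seteqP; split=> // f _ /np].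
- apply: closed_bigI => c _; apply: closed_eqfun; first exact: qdot_eval_continuous.
  exact: cst_continuous.
Qed.

Lemma normalized_pd_le1 f g : normalized_pd f -> qnorm2 (f g) <= 1.
Proof.
move=> [herm gram f0]; have := gram_value_le g herm gram.
by rewrite f0 /qone /mkquat /qre /= expr1n.
Qed.

Lemma normalized_pd_compact : compact normalized_pd.
Proof.
apply: bounded_closed_compact normalized_pd_closed _ => f Kf g.
exact: normalized_pd_le1.
Qed.

(* The subtracted term keeps the value [1] at [0]; the weight [1/3] leaves a
   nonnegative multiple of [f] after [gram_translate] is used. *)
Lemma normalized_pd_perturb f a (e : R) : normalized_pd f -> `|e| = 3^-1 ->
  normalized_pd (fun g => qcomb (1 - e * qre (f a)) (e / 2) (e / 2)
                                (f g) (f (g + a)) (f (g - a))).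
Proof.
move=> Kf e3; have [herm gram f0] := Kf; split.
- move=> g; rewrite qconj_comb -!herm opprD opprB.
  rewrite (addrC a (- g)).
  by apply: quat_eqP; rewrite /qcomb /mkquat /qre /qi /qj /qk /=; ring.
- move=> k g q; rewrite gram_comb.
  have := gram k g q; have := gram_translate a g q gram (e := 3 * e).
  have -> : `|3 * e| = 1 by rewrite normrM e3 ger0_norm//; lra.
  move=> /(_ erefl).
  set A := gram_form f g q; set B := gram_form (fun x => f (x + a)) g q.
  set D := gram_form (fun x => f (x - a)) g q => h A0.
  have l1 : `|qre (f a)| <= 1.
    have := normalized_pd_le1 a Kf; rewrite /qnorm2.
    have := sqr_ge0 (qi (f a)); have := sqr_ge0 (qj (f a)); have := sqr_ge0 (qk (f a)).
    by rewrite ler_norml => *; apply/andP; split; nra.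
  have el : e * qre (f a) <= 3^-1.
    by rewrite (le_trans (ler_norm _))// normrM e3 ler_piMr//; lra.
  (* The form of the perturbation is this term plus a third of the bound [h]; the coefficient of [A]
     is at least [1 / 3]. *)
  have : 0 <= (1 - e * qre (f a) - 3^-1) * A by rewrite mulr_ge0//; lra.
  lra.
- rewrite add0r sub0r herm f0.
  by apply: quat_eqP; rewrite /qcomb /qone /qconj /mkquat /qre /qi /qj /qk /=; lra.
Qed.

Lemma trig_normalized_pd_le s M f : (forall gamma : X, qchars gamma -> trig s gamma <= M) ->
  normalized_pd f -> trig s f <= M.
Proof.
move=> sM Kf.
have [psi [Kpsi psimax psiext]] := extreme_maximizer (@trig_continuous R G)
  normalized_pd_compact s normalized_pd_closed (ex_intro _ f Kf).
have [herm gram psi0] := Kpsi.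
apply: le_trans (psimax _ Kf) _.
have dA c g a : qdot c (psi (g + a)) + qdot c (psi (g - a)) =
    2 * qre (psi a) * qdot c (psi g).
  have e3 : `|3^-1| = 3^-1 :> R by rewrite ger0_norm// invr_ge0.
  have eN3 : `|- 3^-1| = 3^-1 :> R by rewrite normrN.
  have Kp := normalized_pd_perturb a Kpsi e3.
  have Kn := normalized_pd_perturb a Kpsi eN3.
  (* [psi] is the midpoint of its perturbations for [e = 1/3] and [e = - 1/3]. Extremality equates
     them with [psi], which is the d'Alembert equation. *)
  have mid := psiext _ _ Kp Kn.
  lapply mid; last by move=> t; rewrite !trig_comb; lra.
  by move=> /(_ [:: (c, g)]); rewrite !trig1 qdot_comb; lra.
have [t [g1 [g2 [t01 c1 c2 e]]]] := dalembert_average_chars psi0 herm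
  (fun g => normalized_pd_le1 g Kpsi) dA.
have -> : trig s psi = t * trig s g1 + (1 - t) * trig s g2.
  rewrite /trig !mulr_sumr -big_split; apply: eq_bigr => -[c g] _ /=; exact: e.
have := sM _ c1; have := sM _ c2; move: t01 => /andP[t0 t1] h2 h1.
rewrite -subr_ge0 in h1; rewrite -subr_ge0 in h2; rewrite -subr_ge0 in t1.
by have := mulr_ge0 t0 h1; have := mulr_ge0 t1 h2; lra.
Qed.

(** Division by [phi 0] reduces to the normalized case; if [phi 0 = 0], then [gram_value_le] makes
    [phi] vanish. *)
Lemma trig_pd_le s M phi : hermitian phi -> gram_nonneg phi ->
  (forall gamma : X, qchars gamma -> trig s gamma <= M) ->
  trig s phi <= qre (phi 0) * M.
Proof.
move=> herm gram sM; have r0 := gram_value0_ge0 gram.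
have [rz|rN0] := eqVneq (qre (phi 0)) 0.
  rewrite rz mul0r.
  suff z g : phi g = mkquat 0 0 0 0.
    rewrite /trig big1// => -[c g] _ /=; rewrite z /qdot /mkquat /qre /qi /qj /qk /=; lra.
  have := gram_value_le g herm gram; rewrite rz expr0n /= /qnorm2.
  case: (phi g) => [[[a b] c] d]; rewrite /qre /qi /qj /qk /= => le0.
  have := sqr_ge0 a; have := sqr_ge0 b; have := sqr_ge0 c; have := sqr_ge0 d.
  by move=> *; congr (_, _, _, _); apply/eqP; rewrite -sqrf_eq0; apply/eqP; lra.
set r := qre (phi 0) in r0 rN0 *.
have rp : 0 < r by rewrite lt_neqAle eq_sym rN0.
have rV : 0 <= r^-1 by rewrite invr_ge0.
have Kf : normalized_pd (fun g => qcomb r^-1 0 0 (phi g) (phi g) (phi g)).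
  split.
  - by move=> g; rewrite qconj_comb herm.
  - by move=> k g q; rewrite gram_comb !mul0r !addr0 mulr_ge0.
  - rewrite (hermitian0 herm) -/r.
    apply: quat_eqP; rewrite /qcomb /qone /mkquat /qre /qi /qj /qk /= ?mul0r ?addr0; last 3 first.
    + by rewrite mulr0.
    + by rewrite mulr0.
    + by rewrite mulr0.
    by rewrite mulVf.
have := trig_normalized_pd_le sM Kf; rewrite trig_comb !mul0r !addr0.
by rewrite ler_pdivrMl.
Qed.

End NormalizedPositiveDefinite.

(** * Hahn-Banach extension of evaluation at [phi] *)

Section RepresentingFunctional.
Variables (R : realType) (G : zmodType) (phi : G -> quat R).
Hypothesis herm : hermitian phi.
Hypothesis gram : gram_nonneg phi.
Local Notation T := (qdual R G).

Definition trig_majorants (f : T -> R) : set R :=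
  [set trig s phi | s in [set s | forall x : T, f x <= trig s (set_val x)]].

(** The sublinear functional fed to Hahn-Banach: the infimum of the values at [phi] of trigonometric
    polynomials lying above [f] on the dual. *)
Definition trig_envelope (f : T -> R) : R := inf (trig_majorants f).

(** Every character is [1] at [0], so constants are trigonometric polynomials supported there. *)
Let const_trig M : exists s : seq (quat R * G), forall x : T, trig s (set_val x) = M.
Proof.
exists [:: (mkquat M 0 0 0, 0)] => x; rewrite trig1 qchar0; last exact: set_valP.
by rewrite /qdot /qone /mkquat /qre /qi /qj /qk /=; lra.
Qed.

Let majorants_neq0 f : bounded_real f -> trig_majorants f !=set0.
Proof.
move=> [M fM]; have [s sM] := const_trig M.
exists (trig s phi), s => // x; rewrite sM; exact: le_trans (ler_norm _) (fM x).
Qed.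

(** Positive definiteness enters here: the negative of a majorant is at most [M] on all characters,
    so [trig_pd_le] bounds it at [phi]. *)
Let majorants_lbound f : bounded_real f -> has_lbound (trig_majorants f).
Proof.
move=> [M fM]; exists (- (qre (phi 0) * M)) => _ [s sf <-].
rewrite lerNl -mulN1r -trig_scaleE; apply: trig_pd_le => // gamma cg.
rewrite trig_scaleE mulN1r lerNl.
have := sf (exist _ gamma (mem_set cg)); apply: le_trans.
by rewrite lerNl (le_trans (ler_norm _))// normrN.
Qed.

Let envelope_le f s : bounded_real f -> (forall x : T, f x <= trig s (set_val x)) ->
  trig_envelope f <= trig s phi.
Proof. by move=> bf fs; apply: ge_inf; [exact: majorants_lbound|exists s]. Qed.

Let envelope_ge f c : bounded_real f ->
  (forall s, (forall x : T, f x <= trig s (set_val x)) -> c <= trig s phi) ->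
  c <= trig_envelope f.
Proof.
move=> bf h; apply: lb_le_inf; first exact: majorants_neq0.
by move=> _ [s sf <-]; exact: h.
Qed.

Lemma trig_envelope_sublinear :
  sublinear_on (@bounded_real R T) trig_envelope.
Proof.
split=> [f g bf bg|t f t0 bf].
  have bfg := bounded_add bf bg.
  rewrite -lerBlDl; apply: (envelope_ge bg) => s2 h2; rewrite lerBlDl -lerBlDr.
  apply: (envelope_ge bf) => s1 h1; rewrite lerBlDr -trig_cat.
  apply: envelope_le => // x; rewrite trig_cat; exact: lerD.
rewrite -ler_pdivrMl//; apply: (envelope_ge bf) => s h; rewrite ler_pdivrMl//.
rewrite -trig_scaleE; apply: envelope_le; first exact: (bounded_scale t bf).
by move=> x; rewrite trig_scaleE; apply: ler_wpM2l; [exact: ltW|exact: h].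
Qed.

(** Positivity holds because the zero polynomial lies above [- f]. The value on a coordinate
    function is exact because that function and its negative are both their own majorants. *)
Lemma representing_functional : exists L : (T -> R) -> R, [/\
  forall f g, bounded_real f -> bounded_real g -> L (fun x => f x + g x) = L f + L g,
  forall t f, bounded_real f -> L (fun x => t * f x) = t * L f,
  forall f, bounded_real f -> (forall x, 0 <= f x) -> 0 <= L f &
  forall c g, qnorm2 c = 1 -> L (fun x => qdot c (set_val x g)) = qdot c (phi g)].
Proof.
have [L [Lp LD LZ]] := dominated_linear (@bounded_add R T) (@bounded_scale R T)
  trig_envelope_sublinear.
exists L; split=> //.
  move=> f bf f0; have bN := bounded_scale (-1) bf.
  have := Lp _ bN; have -> := LZ (-1) f bf.
  have : trig_envelope (fun x => -1 * f x) <= trig [::] phi.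
    by apply: envelope_le => // x; rewrite /trig big_nil; have := f0 x; lra.
  by rewrite /trig big_nil; lra.
move=> c g c1.
have bf : bounded_real (fun x : T => qdot c (set_val x g)).
  by exists 1 => x; apply: qchar_qdot_le1 => //; exact: set_valP.
have bN := bounded_scale (-1) bf.
have h1 : L (fun x => qdot c (set_val x g)) <= qdot c (phi g).
  apply: le_trans (Lp _ bf) _; rewrite -trig1.
  by apply: envelope_le => // x; rewrite trig1.
have := Lp _ bN; have -> := LZ (-1) _ bf.
have : trig_envelope (fun x => -1 * qdot c (set_val x g)) <= - qdot c (phi g).
  have -> : - qdot c (phi g) = trig (trig_scale (-1) [:: (c, g)]) phi.
    by rewrite trig_scaleE trig1 mulN1r.
  by apply: envelope_le => // x; rewrite trig_scaleE trig1.
by lra.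
Qed.

End RepresentingFunctional.

(** * The integral representation and its converse *)

Lemma qdot_components (R : realType) (x : quat R) :
  [/\ qre x = qdot (mkquat 1 0 0 0) x, qi x = qdot (mkquat 0 1 0 0) x,
      qj x = qdot (mkquat 0 0 1 0) x & qk x = qdot (mkquat 0 0 0 1) x].
Proof. by split; rewrite /qdot /mkquat /qre /qi /qj /qk /=; lra. Qed.

Lemma qnorm2_basis (R : realType) :
  [/\ qnorm2 (mkquat 1 0 0 0 : quat R) = 1, qnorm2 (mkquat 0 1 0 0 : quat R) = 1,
      qnorm2 (mkquat 0 0 1 0 : quat R) = 1 & qnorm2 (mkquat 0 0 0 1 : quat R) = 1].
Proof. by split; rewrite /qnorm2 /mkquat /qre /qi /qj /qk /= !expr2; lra. Qed.

Section IntegralRepresentation.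
Variables (R : realType) (G : zmodType) (phi : G -> quat R).

(** Unit vectors [c] keep the integrands within [[-1, 1]], the range covered by [riesz_markov]; the
    four basis vectors are such. *)
Lemma positive_definite_integral : positive_definite phi ->
  exists mu : {measure set (qdual_borel R G) -> \bar R},
    finite_radon mu /\ forall c g, qnorm2 c = 1 ->
      (qdot c (phi g))%:E = (\int[mu]_(x in setT) (qdot c (set_val x g))%:E)%E.
Proof.
move=> /positive_definiteP[herm gram].
have [L [LD LZ L0 Lphi]] := representing_functional herm gram.
have [mu [muT mureg muL]] := riesz_markov (@qdual_hausdorff R G) (@qdual_compact R G) LD LZ L0.
exists mu; split=> // c g c1; rewrite -(Lphi c g c1) -muL//.
  have := @trig_qdual_continuous R G [:: (c, g)].
  by rewrite (_ : (fun x => _) = fun x : qdual R G => qdot c (set_val x g))//;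
    apply/funext => x; rewrite trig1.
by move=> x; apply: qchar_qdot_le1 => //; exact: set_valP.
Qed.

Section Converse.
Variable mu : {measure set (qdual_borel R G) -> \bar R}.
Hypothesis mu_fin : (mu setT < +oo)%E.
Hypothesis mu_phi : forall g,
  [/\ (qre (phi g))%:E = (\int[mu]_(x in setT) (qre (set_val x g))%:E)%E,
      (qi (phi g))%:E = (\int[mu]_(x in setT) (qi (set_val x g))%:E)%E,
      (qj (phi g))%:E = (\int[mu]_(x in setT) (qj (set_val x g))%:E)%E &
      (qk (phi g))%:E = (\int[mu]_(x in setT) (qk (set_val x g))%:E)%E].

Let integrable_trig s :
  mu.-integrable setT (EFin \o (fun x : qdual_borel R G => trig s (set_val x))).
Proof.
apply: measurable_bounded_integrable => //.
  exact: (continuous_borel_measurable (@trig_qdual_continuous R G s)).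
have := continuous_compact (f := fun x : qdual R G => trig s (set_val x)) _ (@qdual_compact R G).
have cs : {within setT, continuous (fun x : qdual R G => trig s (set_val x))}.
  by apply: continuous_subspaceT; exact: trig_qdual_continuous.
move=> /(_ cs)/compact_bounded[M [Mr hM]]; exists M; split=> // N MN x _.
by apply: hM => //; exists x.
Qed.

(** The hypothesis concerns the four coordinates only; a general coefficient [c] is split along the
    basis into [s4], and linearity of the integral does the rest. *)
Let integral_trig s : trig s phi = \int[mu]_(x in setT) trig s (set_val x).
Proof.
have single c (h : quat R -> R) g : (forall x, h x = qdot c x) ->
    (h (phi g))%:E = (\int[mu]_(x in setT) (h (set_val x g))%:E)%E ->
    trig [:: (c, g)] phi = \int[mu]_(x in setT) trig [:: (c, g)] (set_val x).
  move=> hE e; rewrite trig1 -hE -[LHS]/(fine (h (phi g))%:E) e; congr fine.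
  by apply: eq_integral => x _; rewrite trig1 hE.
have re1 g := single (mkquat 1 0 0 0) (@qre R) g (fun x => let: And4 h _ _ _ := qdot_components x in h)
  (let: And4 h _ _ _ := mu_phi g in h).
have i1 g := single (mkquat 0 1 0 0) (@qi R) g (fun x => let: And4 _ h _ _ := qdot_components x in h)
  (let: And4 _ h _ _ := mu_phi g in h).
have j1 g := single (mkquat 0 0 1 0) (@qj R) g (fun x => let: And4 _ _ h _ := qdot_components x in h)
  (let: And4 _ _ h _ := mu_phi g in h).
have k1 g := single (mkquat 0 0 0 1) (@qk R) g (fun x => let: And4 _ _ _ h := qdot_components x in h)
  (let: And4 _ _ _ h := mu_phi g in h).
have addi s1 s2 : trig s1 phi = \int[mu]_(x in setT) trig s1 (set_val x) ->
    trig s2 phi = \int[mu]_(x in setT) trig s2 (set_val x) ->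
    trig (s1 ++ s2) phi = \int[mu]_(x in setT) trig (s1 ++ s2) (set_val x).
  move=> e1 e2; rewrite trig_cat e1 e2 -RintegralD//.
  by apply: eq_Rintegral => x _; rewrite trig_cat.
have scalei r s1 : trig s1 phi = \int[mu]_(x in setT) trig s1 (set_val x) ->
    trig (trig_scale r s1) phi = \int[mu]_(x in setT) trig (trig_scale r s1) (set_val x).
  move=> e1; rewrite trig_scaleE e1 -RintegralZl//.
  by apply: eq_Rintegral => x _; rewrite trig_scaleE.
elim: s => [|[c g] s IH].
  rewrite /trig big_nil; under eq_Rintegral do rewrite big_nil.
  by rewrite Rintegral_cst// mul0r.
pose s4 := trig_scale (qre c) [:: (mkquat 1 0 0 0, g)] ++
  trig_scale (qi c) [:: (mkquat 0 1 0 0, g)] ++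
  trig_scale (qj c) [:: (mkquat 0 0 1 0, g)] ++
  trig_scale (qk c) [:: (mkquat 0 0 0 1, g)].
have s4E f : trig s4 f = trig [:: (c, g)] f.
  rewrite /s4 !trig_cat !trig_scaleE !trig1.
  have [<- <- <- <-] := qdot_components (f g).
  by rewrite /qdot; lra.
rewrite -cat1s; apply: (addi _ _ _ IH); rewrite -s4E.
transitivity (\int[mu]_(x in setT) trig s4 (set_val x)).
  exact: (addi _ _ (scalei _ _ (re1 g)) (addi _ _ (scalei _ _ (i1 g))
    (addi _ _ (scalei _ _ (j1 g)) (scalei _ _ (k1 g))))).
by apply: eq_Rintegral => x _; rewrite s4E.
Qed.

(** Both conditions are real-linear in the function, so they pass from characters through the
    integral. *)
Lemma integral_positive_definite : positive_definite phi.
Proof.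
apply/positive_definiteP; split.
  move=> g; apply: qdot_inj => c; rewrite -qdot_conj -!trig1 !integral_trig.
  apply: eq_Rintegral => x _; rewrite !trig1 qcharN; last exact: set_valP.
  by rewrite qdot_conj.
move=> k g q; rewrite gram_trig integral_trig; apply: Rintegral_ge0 => x _.
by rewrite -gram_trig; apply: qchar_gram; exact: set_valP.
Qed.

End Converse.

End IntegralRepresentation.

Theorem mainTheorem12 (R : realType) (G : zmodType) (phi : G -> quat R) :
  positive_definite phi <->
  exists mu : {measure set (qdual_borel R G) -> \bar R},
    finite_radon mu /\
    forall g : G,
      [/\ (qre (phi g))%:E = (\int[mu]_(x in setT) (qre (set_val x g))%:E)%E,
          (qi (phi g))%:E = (\int[mu]_(x in setT) (qi (set_val x g))%:E)%E,
          (qj (phi g))%:E = (\int[mu]_(x in setT) (qj (set_val x g))%:E)%E &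
          (qk (phi g))%:E = (\int[mu]_(x in setT) (qk (set_val x g))%:E)%E].
Proof.
have [n1 n2 n3 n4] := qnorm2_basis R.
split=> [/positive_definite_integral[mu [murad muphi]]|[mu [[mufin _] muphi]]].
  exists mu; split=> // g; have [-> -> -> ->] := qdot_components (phi g).
  split; rewrite muphi//; apply: eq_integral => x _;
    by have [e1 e2 e3 e4] := qdot_components (set_val x g); rewrite ?e1 ?e2 ?e3 ?e4.
exact: integral_positive_definite mufin muphi.
Qed.
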